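(* Let $p\ge 2$. There is an iterative algorithm for the $\ell_p$ regression problem $\min_{x\in\mathbb{R}^n\colon Ax=b}\|x\|_p$ that solves $O\left(\log\log n+\log(1/\epsilon)\right)$ subproblems, each of which makes $$O\Big(\Big(\big(\tfrac{1}{\epsilon}\big)^{\frac{2p-3}{p-2}}+n^{\frac{p-2}{3p-2}}\big(\tfrac{1}{\epsilon}\big)^{\frac{3p^{2}-4p}{3p^{2}-8p+4}}\Big)\log\Big(\frac{n}{\epsilon^{\frac{p}{p-2}}}\Big)\Big)$$ calls to solve a linear system of the form $ADA^{\top}\phi=b$, where $D$ is an arbitrary non-negative diagonal matrix, and which outputs a solution $x$ with $Ax=b$ and $\|x\|_p\le(1+\epsilon)\min_{x'\colon Ax'=b}\|x'\|_p$.
   Context: The input to the $\ell_p$ regression problem is a matrix $A\in\mathbb{R}^{d\times n}$, a vector $b\in\mathbb{R}^d$ lying in the column span of $A$, and an accuracy parameter $\epsilon>0$. The goal is to find $x\in\mathbb{R}^n$ with $Ax=b$ and $\|x\|_p\le(1+\epsilon)\|x^*\|_p$, where $x^*$ is an optimal solution of $\min_{x\colon Ax=b}\|x\|_p$. *)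

(* Defs.v *)
From HB Require Import structures.
From mathcomp Require Import all_boot all_order all_algebra.
From mathcomp Require Import all_classical all_reals all_analysis.

Set Implicit Arguments.
Unset Strict Implicit.
Unset Printing Implicit Defensive.

Import Order.TTheory GRing.Theory Num.Theory.
Local Open Scope ring_scope.

Definition lp_norm (R : realType) (p : R) (n : nat) (x : 'cV[R]_n) : R :=
  (\sum_(i < n) `|x i ord0| `^ p) `^ p^-1.

Definition lp_optimal (R : realType) (p : R) (d n : nat)
    (A : 'M[R]_(d, n)) (b : 'cV[R]_d) (xs : 'cV[R]_n) : Prop :=
  A *m xs = b /\
  forall x : 'cV[R]_n, A *m x = b -> lp_norm p xs <= lp_norm p x.

(* A diagonal matrix D is represented by its diagonal, a row vector. *)
Definition solves (R : realType) (d n : nat) (A : 'M[R]_(d, n)) (b : 'cV[R]_d)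
    (D : 'rV[R]_n) (phi : 'cV[R]_d) : Prop :=
  A *m diag_mx D *m A^T *m phi = b.

Definition valid_call (R : realType) (d n : nat) (A : 'M[R]_(d, n))
    (b : 'cV[R]_d) (D : 'rV[R]_n) : Prop :=
  (forall i, 0 <= D ord0 i) /\ exists phi, solves A b D phi.

(* A D A^T may be singular, in which case a solver may return any solution. *)
Definition is_solver (R : realType) (d n : nat) (A : 'M[R]_(d, n))
    (b : 'cV[R]_d) (solver : 'rV[R]_n -> 'cV[R]_d) : Prop :=
  forall D, valid_call A b D -> solves A b D (solver D).

(* Oracle model: neither A nor b is available to an algorithm, which learns   *)
(* about them only by calling the solver (otherwise the number of calls would *)
(* carry no content). A call on D gives back the solution phi together with   *)
(* A^T phi, from which the iterate D A^T phi can be formed.                   *)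
Inductive oracle_prog (R : realType) (d n : nat) (T : Type) : Type :=
  | Return of T
  | Solve of 'rV[R]_n & ('cV[R]_d -> 'cV[R]_n -> oracle_prog R d n T).

Inductive iter_alg (R : realType) (d n : nat) : Type :=
  | Output of 'cV[R]_n
  | Subproblem (T : Type) of oracle_prog R d n T & (T -> iter_alg R d n).

Fixpoint run_prog (R : realType) (d n : nat) (A : 'M[R]_(d, n))
    (solver : 'rV[R]_n -> 'cV[R]_d) (T : Type) (P : oracle_prog R d n T) :
    T * seq 'rV[R]_n :=
  match P with
  | Return s => (s, [::])
  | Solve D k =>
      let phi := solver D in
      let r := run_prog A solver (k phi (A^T *m phi)) in
      (r.1, D :: r.2)
  end.

(* The output of an algorithm, and for each subproblem it solves the list of *)
(* the calls made there.                                                     *)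
Fixpoint run_alg (R : realType) (d n : nat) (A : 'M[R]_(d, n))
    (solver : 'rV[R]_n -> 'cV[R]_d) (a : iter_alg R d n) :
    'cV[R]_n * seq (seq 'rV[R]_n) :=
  match a with
  | Output x => (x, [::])
  | Subproblem T P k =>
      let s := run_prog A solver P in
      let r := run_alg A solver (k s.1) in
      (r.1, s.2 :: r.2)
  end.

Definition subproblem_bound (R : realType) (n : nat) (eps : R) : R :=
  ln (ln n%:R) + ln (1 / eps).

(* For p = 2 three of the exponents have a vanishing denominator. As x / 0 = 0, *)
(* they are then 0 and the value is 2 * ln n, smaller than the limit +oo of the *)
(* formula as p tends to 2 (eps < 1 fixed).                                     *)
Definition call_bound (R : realType) (p : R) (n : nat) (eps : R) : R :=
  ((1 / eps) `^ ((2 * p - 3) / (p - 2))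
   + n%:R `^ ((p - 2) / (3 * p - 2))
     * (1 / eps) `^ ((3 * p ^+ 2 - 4 * p) / (3 * p ^+ 2 - 8 * p + 4)))
  * ln (n%:R / eps `^ (p / (p - 2))).

(* Main.v *)
Require Import Defs.
From HB Require Import structures.
From mathcomp Require Import all_boot all_order all_algebra.
From mathcomp Require Import all_classical all_reals all_analysis.
From mathcomp Require Import ring lra.

Set Implicit Arguments.
Unset Strict Implicit.
Unset Printing Implicit Defensive.

Import Order.TTheory GRing.Theory Num.Theory.
Import numFieldNormedType.Exports.
Local Open Scope ring_scope.

(* Write q = p / (p - 2). By Hoelder duality the squared optimum is the maximum
   over weights r > 0 of the energy min { sum_i r_i x_i^2 | A x = b } divided by
   the q-norm of r, and the energy is computed by one linear system. For a
   guess M of the optimum, start from uniform weights of q-norm 1 and, whenever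
   |x_i| exceeds (1 + delta) M (r_i / |r|_q)^(1/(p-2)), multiply r_i by the
   factor a_i which makes the energy grow by at least M^2 times the growth of
   |r|_q. If M is at least 1 + delta times the optimum, |r|_q then stays below
   1/delta. Iterates in which some a_i exceeds S^2 are discarded: each of them
   increases the energy so much that there are few. In the sum of the other
   iterates, coordinate i exceeds its targets by at most
   M r_i^(1/(p-2)) (1/delta + S) ln (r_i / r_min), up to a constant, because
   sqrt a <= (1/delta + S) ln a; so the average has norm at most
   (1 + 2 delta) M. Balancing both counts with S of order n^((p-2)/(3p-2)) gives
   the number of calls, and a bisection on ln M, started from the least squares
   solution, finds the right guess. *)

(** * Finite p-norms *)

Lemma ler_powR2 (R : realType) (p x y : R) : 0 < p -> 0 <= x -> 0 <= y ->
  (x `^ p <= y `^ p) = (x <= y).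
Proof.
move=> p0 x0 y0; apply/idP/idP => [|xy].
  by apply: contraLR; rewrite -!ltNge; apply: gt0_ltr_powR => //; rewrite nnegrE.
by apply: ge0_ler_powR => //; [exact: ltW|rewrite nnegrE..].
Qed.

Lemma powRV (R : realType) (u c : R) : 0 <= u -> u^-1 `^ c = (u `^ c)^-1.
Proof. by move=> u0; rewrite -(powR_inv1 u0) -powRrM mulN1r powRN. Qed.

Section pnorm.
Variables (R : realType) (n : nat).
Implicit Types (p q c : R) (f g a b : 'I_n -> R).

Definition pnorm p f : R := (\sum_i `|f i| `^ p) `^ p^-1.

Lemma sum_powR_ge0 p f : 0 <= \sum_i `|f i| `^ p.
Proof. by apply: sumr_ge0 => i _; exact: powR_ge0. Qed.

Lemma pnorm_ge0 p f : 0 <= pnorm p f.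
Proof. exact: powR_ge0. Qed.

Lemma powR_pnorm p f : p != 0 -> pnorm p f `^ p = \sum_i `|f i| `^ p.
Proof.
by move=> p0; rewrite /pnorm -powRrM mulVf// powRr1// sum_powR_ge0.
Qed.

Lemma pnorm_le p f c : 0 < p -> 0 <= c ->
  (pnorm p f <= c) = (\sum_i `|f i| `^ p <= c `^ p).
Proof.
by move=> p0 c0; rewrite -(ler_powR2 p0) ?pnorm_ge0// powR_pnorm ?gt_eqF.
Qed.

Lemma le_pnorm p f g : 0 < p -> (forall i, `|f i| <= `|g i|) ->
  pnorm p f <= pnorm p g.
Proof.
move=> p0 fg; rewrite pnorm_le ?pnorm_ge0// powR_pnorm ?gt_eqF//.
by apply: ler_sum => i _; rewrite ler_powR2.
Qed.

Lemma eq_pnorm p f g : (forall i, f i = g i) -> pnorm p f = pnorm p g.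
Proof. by move=> fg; congr (_ `^ _); apply: eq_bigr => i _; rewrite fg. Qed.

Lemma le_coord_pnorm p f i : 0 < p -> `|f i| <= pnorm p f.
Proof.
move=> p0; rewrite -(ler_powR2 p0) ?pnorm_ge0// powR_pnorm ?gt_eqF//.
rewrite (bigD1 i)//= lerDl; apply: sumr_ge0 => j _; exact: powR_ge0.
Qed.

Lemma pnorm_eq0_coord p f i : 0 < p -> pnorm p f = 0 -> f i = 0.
Proof.
move=> p0 f0; apply/eqP; rewrite -normr_le0 -f0; exact: le_coord_pnorm.
Qed.

Lemma pnormZ p f c : 0 < p -> pnorm p (fun i => c * f i) = `|c| * pnorm p f.
Proof.
move=> p0; rewrite /pnorm.
under eq_bigr do rewrite normrM powRM//.
rewrite -mulr_sumr powRM ?powR_ge0 ?sum_powR_ge0// -powRrM mulfV ?gt_eqF//.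
by rewrite powRr1.
Qed.

Lemma pnorm0 p : 0 < p -> pnorm p (fun=> 0) = 0.
Proof.
move=> p0; rewrite /pnorm big1 ?powR0 ?invr_eq0 ?gt_eqF// => i _.
by rewrite normr0 powR0 ?gt_eqF.
Qed.

(** The factor [n] is cruder than [n^(1/p)], but enough for continuity and for the starting interval
    of the bisection. *)
Lemma pnorm_le_max p f c : 1 <= p -> 0 <= c -> (forall i, `|f i| <= c) ->
  pnorm p f <= n%:R * c.
Proof.
move=> p1 c0 fc; have p0 : 0 < p by apply: lt_le_trans p1.
rewrite pnorm_le ?mulr_ge0// powRM//.
apply: (@le_trans _ _ (\sum_(i < n) c `^ p)).
  by apply: ler_sum => i _; rewrite ler_powR2.
rewrite sumr_const card_ord -[leLHS]mulr_natl ler_wpM2r ?powR_ge0//.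
have [->|n0] := posnP n; first by rewrite powR_ge0.
by rewrite le1r_powR// ler1n.
Qed.

Lemma pnorm_powR p q f : 0 < p -> 0 < q ->
  pnorm p (fun i => `|f i| `^ q) = pnorm (p * q) f `^ q.
Proof.
move=> p0 q0; rewrite /pnorm -powRrM.
rewrite (_ : (p * q)^-1 * q = p^-1); last by field; rewrite !gt_eqF.
congr (_ `^ _); apply: eq_bigr => i _.
by rewrite ger0_norm ?powR_ge0// -powRrM mulrC.
Qed.

Lemma young_powR q (u v : R) : 1 < q -> 0 <= u -> 0 <= v ->
  u * v `^ (q - 1) <= u `^ q / q + v `^ q * ((q - 1) / q).
Proof.
move=> q1 u0 v0; have q0 : 0 < q by apply: lt_trans q1.
have q10 : 0 < q - 1 by rewrite subr_gt0.
have := @conjugate_powR R u (v `^ (q - 1)) q (q / (q - 1)) u0 (powR_ge0 _ _) q0.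
rewrite divr_gt0// => /(_ isT).
have -> : q^-1 + (q / (q - 1))^-1 = 1 by field; rewrite !gt_eqF.
rewrite -powRrM (_ : (q - 1) * (q / (q - 1)) = q).
  by rewrite invf_div; apply.
by field; rewrite gt_eqF.
Qed.

Lemma sum_normalized q f : 0 < q -> 0 < pnorm q f ->
  \sum_i (`|f i| / pnorm q f) `^ q = 1.
Proof.
move=> q0 f0; have := powR_pnorm f (lt0r_neq0 q0).
move: (pnorm q f) f0 => N N0 E.
transitivity (\sum_i `|f i| `^ q * N^-1 `^ q).
  by apply: eq_bigr => i _; rewrite powRM// invr_ge0 ltW.
rewrite -mulr_suml -E -powRM ?invr_ge0 ?ltW//.
by rewrite mulfV ?gt_eqF// powR1.
Qed.

(** Young's inequality for the vectors scaled to norm 1, summed over the coordinates. With the power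
    [q - 1] on the second factor no conjugate exponent appears, which suits Minkowski, the growth of
    the [q]-norm and the energy at the optimum. *)
Lemma hoelder_sum q a b : 1 < q ->
  \sum_i `|a i| * `|b i| `^ (q - 1) <= pnorm q a * pnorm q b `^ (q - 1).
Proof.
move=> q1; have q0 : 0 < q by apply: lt_trans q1.
have q10 : 0 < q - 1 by rewrite subr_gt0.
have := pnorm_ge0 q a; rewrite le_eqVlt => /predU1P[/esym a0|a0].
  rewrite a0 mul0r big1// => i _.
  by rewrite (pnorm_eq0_coord _ q0 a0) normr0 mul0r.
have := pnorm_ge0 q b; rewrite le_eqVlt => /predU1P[/esym b0|b0].
  rewrite b0 powR0 ?gt_eqF// mulr0 big1// => i _.
  by rewrite (pnorm_eq0_coord _ q0 b0) normr0 powR0 ?mulr0// gt_eqF.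
have := sum_normalized q0 a0; have := sum_normalized q0 b0.
move: (pnorm q a) (pnorm q b) a0 b0 => s t s0 t0 Et Es.
have E : \sum_i ((`|a i| / s) `^ q / q + (`|b i| / t) `^ q * ((q - 1) / q)) = 1.
  by rewrite big_split/= -!mulr_suml Et Es; field; rewrite gt_eqF.
rewrite -[leRHS]mulr1 -[X in _ <= _ * X]E mulr_sumr; apply: ler_sum => i _.
apply: le_trans (ler_wpM2l _ (@young_powR q _ _ q1 _ _)).
- rewrite [X in _ <= _ * (_ * X)]powRM ?invr_ge0 ?(ltW t0)//.
  rewrite -(powR_inv1 (ltW t0)) -powRrM mulN1r powRN.
  rewrite le_eqVlt; apply/orP; left; apply/eqP. field.
  by rewrite !gt_eqF// powR_gt0.
- by rewrite mulr_ge0 ?powR_ge0 ?(ltW s0).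
- by rewrite divr_ge0 ?(ltW s0).
- by rewrite divr_ge0 ?(ltW t0).
Qed.

(** Split [|h|^p = |h| |h|^(p-1)], apply Hoelder to both summands of [h] and cancel
    [|h|_p^(p-1)]. *)
Lemma pnormD p f g : 1 < p ->
  pnorm p (fun i => f i + g i) <= pnorm p f + pnorm p g.
Proof.
move=> p1; have p0 : 0 < p by apply: lt_trans p1.
set h := fun i => f i + g i.
have := pnorm_ge0 p h; rewrite le_eqVlt => /predU1P[<-|h0].
  by rewrite addr_ge0 ?pnorm_ge0.
rewrite -(ler_pM2r (powR_gt0 (p - 1) h0)) mulr_powRB1 ?(ltW h0)//.
rewrite powR_pnorm ?gt_eqF// [leRHS]mulrDl.
apply: le_trans (lerD (hoelder_sum f h p1) (hoelder_sum g h p1)).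
rewrite -big_split/=; apply: ler_sum => i _.
by rewrite -mulr_powRB1// -mulrDl ler_wpM2r ?powR_ge0// ler_normD.
Qed.

End pnorm.

Lemma lp_normE (R : realType) (p : R) n (x : 'cV[R]_n) :
  lp_norm p x = pnorm p (fun i => x i ord0).
Proof. by []. Qed.

(** * Existence of an optimum *)

(** Minkowski makes the norm Lipschitz with constant [n] for the sup norm; [n + 1] in the proof
    avoids dividing by 0. *)
Lemma continuous_pnorm_rV (R : realType) (p : R) n : 1 < p ->
  continuous (fun v : 'rV[R]_n => pnorm p (fun i => v ord0 i)).
Proof.
move=> p1 v; have p0 : 0 < p by apply: lt_trans p1.
apply/(@cvgrPdist_le _ _ _ (nbhs v)) => e e0.
have d0 : 0 < e / (n%:R + 1) by rewrite divr_gt0// ltr_wpDl.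
have := @nbhsx_ballx _ _ v _ d0; apply: filterS => w /= vw.
have H (u u' : 'rV[R]_n) : (forall i, `|u ord0 i - u' ord0 i| <= e / (n%:R + 1)) ->
    pnorm p (fun i => u ord0 i) - pnorm p (fun i => u' ord0 i) <= e.
  move=> uu'; rewrite lerBlDr.
  rewrite (@eq_pnorm _ _ p (fun i => u ord0 i)
    (fun i => (u ord0 i - u' ord0 i) + u' ord0 i)); last by move=> i; rewrite subrK.
  apply: le_trans (pnormD _ _ p1) _; rewrite lerD2r.
  apply: le_trans (pnorm_le_max (ltW p1) (ltW d0) uu') _.
  by rewrite mulrCA ler_piMr ?(ltW e0)// ler_pdivrMr ?ltr_wpDl// mul1r lerDl.
have D i : `|v ord0 i - w ord0 i| <= e / (n%:R + 1).
  by apply/ltW; case: vw => _ /(_ ord0 i).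
apply/ler_normlP; split; last exact: H.
by rewrite opprB; apply: H => i; rewrite distrC.
Qed.

Lemma closed_affine_rV (R : realType) d n (A : 'M[R]_(d, n)) (b : 'cV[R]_d) :
  closed [set v : 'rV[R]_n | A *m v^T = b]%classic.
Proof.
have -> : ([set v : 'rV[R]_n | A *m v^T = b] =
    \bigcap_(i in [set: 'I_d])
      [set v : 'rV[R]_n | \sum_j A i j * v ord0 j = b i ord0])%classic.
  apply/seteqP; split => v /=.
    by move=> <- i _ /=; rewrite mxE; apply: eq_bigr => j _; rewrite mxE.
  move=> H; apply/colP => i; rewrite mxE -(H i I).
  by apply: eq_bigr => j _; rewrite mxE.
apply: closed_bigI => i _.
pose f (v : 'rV[R]_n) : R := \sum_j A i j * v ord0 j.
have cf : continuous f.
  apply: (@continuous_big R _ +%R 0 xpredT _ _ (index_enum _)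
    (fun j (w : 'rV[R]_n) => A i j * w ord0 j)); first exact: add_continuous.
  move=> j _ w; apply: (@continuousM R 'rV[R]_n); first exact: cst_continuous.
  exact: (@coord_continuous R 1 n ord0 j).
apply: (@preimage_closed _ _ f [set b i ord0]%classic); last exact: closed_eq.
by move=> v _; exact: cf.
Qed.

(** Feasible points of norm at most [U], the norm of [x0], lie in the box [[-U, U]^n]. The extreme
    value theorem applies to the feasible part of this box, with points as row vectors. *)
Lemma lp_optimal_exists (R : realType) (p : R) d n (A : 'M[R]_(d, n))
    (b : 'cV[R]_d) : 1 < p -> (exists x0, A *m x0 = b) ->
  exists xs, lp_optimal p A b xs.
Proof.
move=> p1 [x0 Ax0]; have p0 : 0 < p by apply: lt_trans p1.
pose U := lp_norm p x0.
pose K : set 'rV[R]_n := ([set v : 'rV[R]_n | forall i, `[- U, U] (v ord0 i)]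
  `&` [set v : 'rV[R]_n | A *m v^T = b])%classic.
have K0 : (K !=set0)%classic.
  exists x0^T; split => /=; last by rewrite trmxK.
  move=> i; rewrite mxE /= in_itv/= -ler_norml.
  exact: (le_coord_pnorm (fun i => x0 i ord0)).
have cK : compact K.
  apply: compact_closedI; last exact: closed_affine_rV.
  apply: (@rV_compact _ _ (fun=> `[- U, U]%classic)) => _.
  exact: segment_compact.
have [c] := EVT_min_rV K0 cK
  (continuous_subspaceT (@continuous_pnorm_rV R p n p1)).
rewrite inE => -[_ Ac] cmin.
have E (x : 'cV[R]_n) :
    pnorm p (fun i => x^T ord0 i) = lp_norm p x.
  by apply: eq_pnorm => i; rewrite mxE.
exists c^T; split; first exact: Ac.
move=> x Ax; rewrite -(E c^T) trmxK.
have /orP[xU|Ux] := le_total (lp_norm p x) U.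
  rewrite -E; apply: cmin; rewrite inE; split => /=; last by rewrite trmxK.
  move=> i; rewrite mxE /= in_itv/= -ler_norml; apply: le_trans xU.
  exact: (le_coord_pnorm (fun i => x i ord0)).
apply: le_trans Ux; rewrite /U -E; apply: cmin.
rewrite inE; split => /=; last by rewrite trmxK.
move=> i; rewrite mxE /= in_itv/= -ler_norml.
exact: (le_coord_pnorm (fun i => x0 i ord0)).
Qed.

(** * Weighted least squares *)

Section weighted_least_squares.
Variables (R : realType) (d n : nat) (A : 'M[R]_(d, n)) (b : 'cV[R]_d).
Implicit Types (r a : 'I_n -> R) (g x y : 'cV[R]_n).

Definition conductances r : 'rV[R]_n := \row_i (r i)^-1.

(** Ohm's law for resistances [r]: with [g = A^T phi] this is the Lagrange condition for minimal
    energy under [A x = b]. *)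
Definition wls_point r g : 'cV[R]_n := \col_i (g i ord0 / r i).

(** For positive [D] the kernel of [A D A^T] is that of [A^T], so both matrices have the same row
    space. *)
Lemma valid_call_gt0 (D : 'rV[R]_n) : (exists x0, A *m x0 = b) ->
  (forall i, 0 < D ord0 i) -> valid_call A b D.
Proof.
move=> [x0 <-] D0; split=> [i|]; first exact: ltW.
set K := cokermx (A *m diag_mx D *m A^T).
have AK : A^T *m K = 0.
  apply/matrixP => i k; rewrite !mxE.
  pose u := col k K; pose v := A^T *m u.
  have Gu : A *m diag_mx D *m A^T *m u = 0.
    by rewrite /u colE mulmxA mulmx_coker mul0mx.
  (* This sum is [u^T A D A^T u]; its terms are nonnegative, so [v = A^T u] vanishes. *)
  have : \sum_j D ord0 j * v j ord0 ^+ 2 = 0.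
    have /(congr1 (fun z : 'M[R]_1 => z ord0 ord0)) :
        u^T *m (A *m diag_mx D *m A^T *m u) = 0 by rewrite Gu mulmx0.
    rewrite -!mulmxA -/v (mulmxA u^T) (_ : u^T *m A = v^T); last first.
      by rewrite /v trmx_mul trmxK.
    rewrite mul_diag_mx !mxE => H; rewrite -[RHS]H; apply: eq_bigr => j _.
    by rewrite !mxE; ring.
  move/eqP; rewrite psumr_eq0 => [/allP/(_ i (mem_index_enum _))|j _].
    rewrite implyTb mulf_eq0 gt_eqF//= sqrf_eq0 => /eqP H; rewrite -[RHS]H.
    by rewrite /v mxE; apply: eq_bigr => j _; rewrite !mxE.
  by rewrite mulr_ge0 ?sqr_ge0 ?(ltW (D0 _)).
(* Transposing [A^T = P A D A^T] gives [A = A D A^T P^T], hence the solution [P^T x0]. *)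
have /submxP[P AP] : (A^T <= A *m diag_mx D *m A^T)%MS by rewrite submxE AK.
exists (P^T *m x0); rewrite /solves mulmxA.
congr (_ *m x0); apply: trmx_inj.
rewrite trmx_mul trmxK {2}AP; congr (_ *m _).
by rewrite !trmx_mul trmxK tr_diag_mx mulmxA.
Qed.

Variables (r : 'I_n -> R) (phi : 'cV[R]_d).
Hypotheses (r0 : forall i, 0 < r i) (phiP : solves A b (conductances r) phi).
Let x := wls_point r (A^T *m phi).

Lemma wls_point_feasible : A *m x = b.
Proof.
rewrite -phiP -!mulmxA; congr (_ *m _).
by apply/colP => i; rewrite mul_diag_mx !mxE mulrC.
Qed.

(** Since [r_i x_i = (A^T phi)_i], the left side is [phi^T A y], which depends on [y] only through
    [A y]. *)
Lemma wls_point_orthogonal y : A *m y = b ->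
  \sum_i r i * x i ord0 * y i ord0 = \sum_i r i * x i ord0 ^+ 2.
Proof.
have E (z : 'cV[R]_n) : \sum_i r i * x i ord0 * z i ord0 =
    (phi^T *m (A *m z)) ord0 ord0.
  rewrite mulmxA !mxE; apply: eq_bigr => i _; congr (_ * _).
  rewrite !mxE mulrCA mulfV ?gt_eqF// mulr1.
  by apply: eq_bigr => j _; rewrite !mxE mulrC.
move=> Ay; transitivity (\sum_i r i * x i ord0 * x i ord0).
  by rewrite !E Ay wls_point_feasible.
by apply: eq_bigr => i _; rewrite expr2 mulrA.
Qed.

(* Complete the square around [x i ord0 / a i]. *)
Lemma wls_energy_growth a y : (forall i, 0 < a i) -> A *m y = b ->
  \sum_i r i * x i ord0 ^+ 2 + \sum_i r i * x i ord0 ^+ 2 * (1 - (a i)^-1)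
  <= \sum_i r i * a i * y i ord0 ^+ 2.
Proof.
move=> a0 Ay.
have -> : \sum_i r i * x i ord0 ^+ 2 +
    \sum_i r i * x i ord0 ^+ 2 * (1 - (a i)^-1) =
    \sum_i (2 * (r i * x i ord0 * y i ord0) - r i * x i ord0 ^+ 2 / a i).
  rewrite sumrB -mulr_sumr wls_point_orthogonal//.
  under [X in _ + X = _]eq_bigr do rewrite mulrBr mulr1.
  by rewrite sumrB; ring.
apply: ler_sum => i _; rewrite -subr_ge0.
rewrite (_ : _ - _ = r i * a i * (y i ord0 - x i ord0 / a i) ^+ 2).
  by rewrite mulr_ge0 ?sqr_ge0// ltW// mulr_gt0.
by field; rewrite gt_eqF.
Qed.

Lemma wls_energy_le y : A *m y = b ->
  \sum_i r i * x i ord0 ^+ 2 <= \sum_i r i * y i ord0 ^+ 2.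
Proof.
move=> Ay; have := wls_energy_growth (fun=> ltr01) Ay.
under [in leRHS]eq_bigr do rewrite mulr1.
by rewrite [X in _ + X]big1 ?addr0// => i _; rewrite invr1 subrr mulr0.
Qed.

End weighted_least_squares.

(** * Reweighting *)

Section reweighting.
Variables (R : realType) (n : nat) (beta M delta : R).
Hypotheses (beta0 : 0 < beta) (M0 : 0 < M) (delta0 : 0 < delta).
Local Notation q := (1 + 2 * beta).
Implicit Types (r a : 'I_n -> R) (x y : 'cV[R]_n).

(* An optimal pair satisfies |x i| = M (r i / |r|_q) ^ beta with M the optimum. *)
Definition target r i : R := M * (r i / pnorm q r) `^ beta.

(** The second branch solves [|x_i| = target * a^(q/2)] for [a], so that the energy gain is
    proportional to the linearized growth of the [q]-norm, coordinate by coordinate. *)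
Definition boost r x i : R :=
  if `|x i ord0| <= (1 + delta) * target r i then 1
  else (`|x i ord0| / target r i) `^ (2 / q).

Definition reweight r x i : R := r i * boost r x i.

Let q1 : 1 < q. Proof. by rewrite ltrDl mulr_gt0. Qed.
Let q0 : 0 < q. Proof. by apply: lt_trans q1. Qed.

Section step.
Variables (r : 'I_n -> R) (x : 'cV[R]_n).
Hypothesis r0 : forall i, 0 < r i.
Local Notation rho := (pnorm q r).

Lemma pnorm_gt0 (i : 'I_n) : 0 < rho.
Proof.
apply: (lt_le_trans (r0 i)); rewrite -(gtr0_norm (r0 i)); exact: le_coord_pnorm.
Qed.

Lemma target_gt0 i : 0 < target r i.
Proof. by rewrite mulr_gt0// powR_gt0// divr_gt0// (pnorm_gt0 i). Qed.

Variant boost_spec i : R -> Prop :=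
| BoostSmall of `|x i ord0| <= (1 + delta) * target r i : boost_spec i 1
| BoostLarge al of (1 + delta) `^ (2 / q) <= al &
    `|x i ord0| = target r i * al `^ (q / 2) : boost_spec i al.

Lemma boostP i : boost_spec i (boost r x i).
Proof.
rewrite /boost; case: ifPn => [|]; first exact: BoostSmall.
rewrite -ltNge => lt; have t0 := target_gt0 i.
have H : 1 + delta < `|x i ord0| / target r i by rewrite ltr_pdivlMr.
have d1 : 0 <= 1 + delta by rewrite addr_ge0// ltW.
have q20 : 0 < 2 / q by rewrite divr_gt0.
apply: BoostLarge; first by rewrite ler_powR2// ltW// (le_lt_trans _ H).
rewrite -powRrM (_ : 2 / q * (q / 2) = 1); last by field; rewrite gt_eqF.
rewrite powRr1; last by rewrite divr_ge0// ltW.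
by rewrite mulrC divfK// gt_eqF.
Qed.

Lemma boost_ge1 i : 1 <= boost r x i.
Proof.
case: boostP => // al + _; apply: le_trans.
have : (1 + delta) `^ 0 <= (1 + delta) `^ (2 / q).
  by apply: ler_powR; rewrite ?lerDl ?divr_ge0 ?(ltW q0) ?(ltW delta0).
by rewrite powRr0.
Qed.

Let boost_gt0 i : 0 < boost r x i.
Proof. by apply: lt_le_trans (boost_ge1 i). Qed.

Lemma reweight_gt0 i : 0 < reweight r x i.
Proof. by rewrite mulr_gt0. Qed.

Lemma le_reweight i : r i <= reweight r x i.
Proof. by rewrite ler_peMr ?boost_ge1// ltW. Qed.

Lemma sqr_target i : target r i ^+ 2 = M ^+ 2 * (r i / rho) `^ (q - 1).
Proof.
rewrite exprMn; congr (_ * _).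
rewrite -powR_mulrn ?powR_ge0// -powRrM; congr (_ `^ _); ring.
Qed.

(** The equation for [a] gives [x_i^2 = M^2 (r_i / rho)^(q-1) a^q], and
    [a^q (1 - 1/a) = a^(q-1) (a - 1)]. *)
Lemma boost_energy i : r i * x i ord0 ^+ 2 * (1 - (boost r x i)^-1) =
  M ^+ 2 * (rho `^ (q - 1))^-1 *
    (r i * reweight r x i `^ (q - 1) * (boost r x i - 1)).
Proof.
rewrite /reweight; have := boost_gt0 i; have rho0 := pnorm_gt0 i.
case: boostP => [_ _|al _ xE al0].
  by rewrite invr1 !subrr !mulr0.
rewrite -[x i ord0 ^+ 2]real_normK ?num_real// xE exprMn sqr_target.
have -> : (al `^ (q / 2)) ^+ 2 = al * al `^ (q - 1).
  rewrite mulr_powRB1 ?(ltW al0)// -powR_mulrn ?powR_ge0// -powRrM.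
  by rewrite divfK ?pnatr_eq0.
rewrite powRM ?invr_ge0 ?(ltW rho0) ?(ltW (r0 i))// powRV ?(ltW rho0)//.
rewrite powRM ?(ltW (r0 i)) ?(ltW al0)//.
field; rewrite (gt_eqF al0) andbT; exact/lt0r_neq0/powR_gt0.
Qed.

(* Convexity of the [q]-norm: its increase is at most the directional
   derivative at the new weights. *)
Lemma pnorm_reweight_growth : M ^+ 2 * (pnorm q (reweight r x) - rho) <=
  \sum_i r i * x i ord0 ^+ 2 * (1 - (boost r x i)^-1).
Proof.
under eq_bigr do rewrite boost_energy.
rewrite -mulr_sumr -mulrA ler_wpM2l ?sqr_ge0//.
case: (pickP (fun i : 'I_n => true)) => [i0 _|no]; last first.
  rewrite (@eq_pnorm _ _ q (reweight r x) r); last by move=> i; have := no i.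
  by rewrite subrr big1 ?mulr0// => i; have := no i.
have rho0 := pnorm_gt0 i0.
set r' := reweight r x; have := hoelder_sum r r' q1.
have r'0 i : 0 < r' i := reweight_gt0 i.
have le_rr' : rho <= pnorm q r'.
  by apply: le_pnorm => // i; rewrite !gtr0_norm ?le_reweight.
have := etrans (mulr_powRB1 (pnorm_ge0 q r') q0) (powR_pnorm r' (lt0r_neq0 q0)).
move: (pnorm q r) (pnorm q r') rho0 le_rr' => s s' s0 ss' E H.
have s'0 : 0 < s' by apply: lt_le_trans ss'.
have P0 : 0 < s' `^ (q - 1) by rewrite powR_gt0.
have -> : \sum_i r i * r' i `^ (q - 1) * (boost r x i - 1) =
    \sum_i `|r' i| `^ q - \sum_i `|r i| * `|r' i| `^ (q - 1).
  rewrite -sumrB; apply: eq_bigr => i _.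
  rewrite !gtr0_norm// -(mulr_powRB1 (ltW (r'0 i)) q0).
  by move: (r' i `^ (q - 1)) => z; rewrite /r' /reweight; ring.
have D0 : 0 <= s' - s by rewrite subr_ge0.
(* Dividing by [s^(q-1)] instead of [s'^(q-1)] only helps, as [s <= s']; Hoelder then bounds the
   mixed sum by [s s'^(q-1)]. *)
rewrite -E mulrC; apply: (@le_trans _ _ ((s' - s) * s' `^ (q - 1) / s `^ (q - 1))).
  rewrite -mulrA ler_peMr// ler_pdivlMr ?powR_gt0// mul1r.
  by rewrite ler_powR2 ?(ltW s0) ?(ltW s'0)// subr_gt0.
by rewrite ler_wpM2r ?invr_ge0 ?powR_ge0// mulrBl lerD2l lerN2.
Qed.

Lemma boost_energy_ge0 i : 0 <= r i * x i ord0 ^+ 2 * (1 - (boost r x i)^-1).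
Proof.
apply: mulr_ge0; first by rewrite mulr_ge0 ?sqr_ge0// ltW.
by rewrite subr_ge0 invf_le1 ?boost_ge1.
Qed.

(** Keep term [i] alone and use [a - 1 >= a / 2]. This makes discarded iterates costly. *)
Lemma boost_energy_large i : 2 <= boost r x i ->
  M ^+ 2 * (rho `^ (q - 1))^-1 * (r i `^ q * boost r x i `^ q / 2) <=
  \sum_j r j * x j ord0 ^+ 2 * (1 - (boost r x j)^-1).
Proof.
move=> b2; rewrite (bigD1 i)//= -[leLHS]addr0; apply: lerD; last first.
  by apply: sumr_ge0 => j _; exact: boost_energy_ge0.
rewrite boost_energy /reweight; have b0 := boost_gt0 i.
move: (boost r x i) b0 b2 => al al0 al2.
apply: ler_wpM2l.
  by apply: mulr_ge0; [exact: sqr_ge0|rewrite invr_ge0 powR_ge0].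
rewrite powRM ?(ltW (r0 i)) ?(ltW al0)// mulrA mulr_powRB1 ?(ltW (r0 i))//.
rewrite -!mulrA ler_wpM2l ?powR_ge0// -(mulr_powRB1 (ltW al0) q0).
by rewrite mulrAC mulrC ler_wpM2l ?powR_ge0//; lra.
Qed.

(** As [q / 2 = beta + 1/2], the new weight absorbs [a^beta] and only [sqrt a] remains; [rho >= 1]
    lets the normalization go. *)
Lemma boost_coord i : 1 <= rho ->
  `|x i ord0| <= (1 + delta) * target r i /\ boost r x i = 1 \/
  (1 + delta) `^ (2 / q) <= boost r x i /\
  `|x i ord0| <= M * (reweight r x i `^ beta * boost r x i `^ 2^-1).
Proof.
move=> rho1; rewrite /reweight; have := boost_gt0 i.
case: boostP => [xi _|al dal -> al0]; [by left|right; split=> //].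
rewrite /target -mulrA ler_wpM2l ?(ltW M0)//.
rewrite (_ : q / 2 = beta + 2^-1); last by field.
rewrite powRD ?(gt_eqF al0) ?implybT// mulrA ler_wpM2r ?powR_ge0//.
rewrite -powRM ?divr_ge0 ?(ltW (r0 i)) ?(ltW al0) ?pnorm_ge0//.
rewrite ler_powR2 ?mulr_ge0 ?(ltW (r0 i)) ?(ltW al0) ?invr_ge0 ?pnorm_ge0//.
rewrite ler_wpM2r ?(ltW al0)// ler_pdivrMr ?(lt_le_trans _ rho1)//.
by rewrite ler_peMr// ltW.
Qed.

End step.
End reweighting.

(** * Scalar inequalities *)

Section real_bounds.
Variable R : realType.
Implicit Types (d u B : R).

Lemma ln1D_ge d : 0 <= d <= 1 -> d / 2 <= ln (1 + d).
Proof.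
move=> /andP[d0 d1]; have D0 : 0 < 1 + d by lra.
have := @le_ln1Dx R (- d / (1 + d)).
have -> : 1 + - d / (1 + d) = (1 + d)^-1 by field; rewrite gt_eqF.
rewrite lnV ?posrE// ltr_pdivlMr// mulN1r ltrN2 ltrDr ltr01 => /(_ isT).
rewrite mulNr lerN2; apply: le_trans.
by rewrite ler_wpM2l// lef_pV2 ?posrE//; lra.
Qed.

Lemma ln4_ge1 : 1 <= ln 4%:R :> R.
Proof.
have -> : 4%:R = 2%:R * 2%:R :> R by rewrite -natrM.
rewrite lnM ?posrE//.
by have := @ln1D_ge 1; rewrite ler01 lexx => /(_ isT); rewrite -[1 + 1]/(2%:R); lra.
Qed.

(** For [u <= 4], [sqrt u <= 2] and the lower bound on [u] gives [ln u >= d / q]. For [u >= 4],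
    [sqrt u <= S] and [ln u >= 1]. A logarithm is wanted because it telescopes over the
    iterations. *)
Lemma sqrt_le_ln q d S u : 1 <= q -> 0 < d <= 1 -> 0 <= S ->
  (1 + d) `^ (2 / q) <= u -> u <= S ^+ 2 ->
  u `^ 2^-1 <= (2 * q / d + S) * ln u.
Proof.
move=> q1 /andP[d0 d1] S0 lu uS; have q0 : 0 < q by apply: lt_le_trans q1.
have D0 : 0 < 1 + d by lra.
have u0 : 0 < u by apply: lt_le_trans lu; rewrite powR_gt0.
have half0 : 0 < 2^-1 :> R by rewrite invr_gt0.
have sqE (c : R) : 0 <= c -> (c ^+ 2) `^ 2^-1 = c.
  by move=> c0; rewrite -powR_mulrn// -powRrM mulfV ?powRr1// pnatr_eq0.
have lnu : d / q <= ln u.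
  have : ln ((1 + d) `^ (2 / q)) <= ln u by rewrite ler_ln ?posrE// powR_gt0.
  rewrite ln_powR; apply: le_trans.
  have := @ln1D_ge d; rewrite d1 (ltW d0) => /(_ isT) H.
  apply: le_trans (ler_wpM2l _ H); last by rewrite divr_ge0// ltW.
  by rewrite le_eqVlt; apply/orP; left; apply/eqP; field; rewrite gt_eqF.
have lnu0 : 0 <= ln u by apply: le_trans lnu; rewrite divr_ge0 ?(ltW d0) ?(ltW q0).
rewrite mulrDl; have [u4|/ltW u4] := leP u 4.
  apply: (@le_trans _ _ 2).
    rewrite -[leRHS](sqE 2)// ler_powR2 ?(ltW u0) ?sqr_ge0//.
    by rewrite expr2 -natrM.
  rewrite -[leLHS]addr0 lerD ?mulr_ge0//.
  apply: (@le_trans _ _ (2 * q / d * (d / q))).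
    by rewrite le_eqVlt; apply/orP; left; apply/eqP; field; rewrite !gt_eqF.
  by rewrite ler_wpM2l// divr_ge0 ?mulr_ge0 ?(ltW d0) ?(ltW q0).
rewrite -[leLHS]add0r lerD//.
  by rewrite mulr_ge0// divr_ge0 ?mulr_ge0 ?(ltW d0) ?(ltW q0).
apply: (@le_trans _ _ S).
  by rewrite -[leRHS](sqE S)// ler_powR2 ?(ltW u0) ?sqr_ge0.
rewrite ler_peMr//; apply: le_trans ln4_ge1 _.
by rewrite ler_ln ?posrE.
Qed.

(** Eliminating [o] leaves [(1 + d)^2 (t - 1) <= t], so [t <= (1 + d)^2 / (d (2 + d))], at most
    [1 / d] for [d <= 1/2]. *)
Lemma weight_norm_bound (M o d t : R) : 0 < d -> d <= 2^-1 -> 0 < M -> 0 <= o ->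
  (1 + d) * o <= M -> 1 <= t -> M ^+ 2 * (t - 1) <= t * o ^+ 2 -> t <= d^-1.
Proof.
move=> d0 d2 M0 o0 oM t1 H; have D0 : 0 < 1 + d by lra.
have H1 : (1 + d) ^+ 2 * o ^+ 2 <= M ^+ 2.
  by rewrite -exprMn ler_sqr ?nnegrE ?mulr_ge0 ?(ltW D0) ?(ltW M0).
have H2 : (1 + d) ^+ 2 * (M ^+ 2 * (t - 1)) <= t * M ^+ 2.
  apply: le_trans (ler_wpM2l (sqr_ge0 _) H) _.
  rewrite mulrCA; apply: ler_wpM2l H1; lra.
have H3 : (1 + d) ^+ 2 * (t - 1) <= t.
  have M20 : 0 < M ^+ 2 by rewrite exprn_gt0.
  by rewrite -(ler_pM2l M20) mulrCA (mulrC _ t).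
rewrite -[leRHS]mul1r ler_pdivlMr//; nra.
Qed.

End real_bounds.

Lemma two_le_sqr (R : realType) (s : R) : 2 <= s -> 2 <= s ^+ 2.
Proof. by move=> s2; nra. Qed.

(** * Loop invariant *)

Section invariant.
Variables (R : realType) (d n : nat) (A : 'M[R]_(d, n)) (b : 'cV[R]_d).
Variables (p M delta S : R) (xs : 'cV[R]_n).
Local Notation beta := ((p - 2)^-1).
Local Notation q := (1 + 2 * beta).
Local Notation rmin := (n%:R `^ (- q^-1)).
Local Notation B := (2 * q / delta + S).
Local Notation gain := (M ^+ 2 * delta `^ (q - 1) * (rmin `^ q * (S ^+ 2) `^ q / 2)).
Implicit Types (r : 'I_n -> R) (x X : 'cV[R]_n) (N w : nat).

Hypotheses (p2 : 2 < p) (n0 : (0 < n)%N) (M0 : 0 < M).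
Hypotheses (delta0 : 0 < delta) (delta_half : delta <= 2^-1) (S2 : 2 <= S).
Hypotheses (Axs : A *m xs = b) (xsM : (1 + delta) * lp_norm p xs <= M).

Let p0 : 0 < p. Proof. by apply: lt_trans p2. Qed.
Let p1 : 1 < p. Proof. by apply: lt_trans p2; rewrite ltr1n. Qed.
Let pB2 : 0 < p - 2. Proof. by rewrite subr_gt0. Qed.
Let beta0 : 0 < beta. Proof. by rewrite invr_gt0. Qed.
Let q1 : 1 < q. Proof. by rewrite ltrDl mulr_gt0. Qed.
Let q0 : 0 < q. Proof. by apply: lt_trans q1. Qed.
Let rmin0 : 0 < rmin. Proof. by rewrite powR_gt0// ltr0n. Qed.
Let pbeta : p * beta = q. Proof. by field; rewrite gt_eqF. Qed.
Let qVbeta : q * (p - 2) = p. Proof. by field; rewrite gt_eqF. Qed.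
Let S0 : 0 <= S. Proof. by apply: le_trans S2. Qed.

(** Hoelder for [r] and [|xs|^(p-2)], with [(p - 2) (q - 1) = 2] and [q (p - 2) = p]. *)
Lemma energy_le_hoelder r : (forall i, 0 < r i) ->
  \sum_i r i * xs i ord0 ^+ 2 <= pnorm q r * lp_norm p xs ^+ 2.
Proof.
move=> r0; have := hoelder_sum r (fun i => `|xs i ord0| `^ (p - 2)) q1.
rewrite (@pnorm_powR _ _ q (p - 2) (fun i => xs i ord0) q0 pB2) qVbeta.
rewrite -powRrM (_ : (p - 2) * (q - 1) = 2); last by field; rewrite gt_eqF.
rewrite powR_mulrn ?pnorm_ge0//; apply: le_trans.
rewrite le_eqVlt; apply/orP; left; apply/eqP; apply: eq_bigr => i _.
rewrite gtr0_norm// ger0_norm ?powR_ge0// -powRrM.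
rewrite (_ : (p - 2) * (q - 1) = 2); last by field; rewrite gt_eqF.
by rewrite powR_mulrn// real_normK ?num_real.
Qed.

Lemma powR_rmin : rmin `^ q = n%:R^-1.
Proof. by rewrite -powRrM mulNr mulVf ?gt_eqF// powR_inv1. Qed.

(* [X] is the sum of the [N] iterates kept so far and [w] counts the discarded
   ones; [Y] collects the coordinates of these iterates that met their target. *)
Definition irls_inv r X N w : Prop :=
  [/\ (forall i, rmin <= r i), 1 <= pnorm q r,
      (forall y, A *m y = b ->
         M ^+ 2 * (pnorm q r - 1) <= \sum_i r i * y i ord0 ^+ 2),
      (forall y, A *m y = b -> w%:R * gain <= \sum_i r i * y i ord0 ^+ 2) &
      exists2 Y : 'I_n -> R, pnorm p Y <= (1 + delta) * M * N%:R &
        forall i, `|X i ord0 - Y i| <= M * B * (r i `^ beta * ln (r i / rmin))].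

Lemma irls_inv_init : irls_inv (fun=> rmin) 0 0 0.
Proof.
have rho1 : pnorm q (fun _ : 'I_n => rmin) = 1.
  rewrite /pnorm; under eq_bigr do rewrite (gtr0_norm rmin0) powR_rmin.
  by rewrite sumr_const card_ord -[X in X `^ _]mulr_natr mulVf ?powR1//
    pnatr_eq0 -lt0n.
have E0 (y : 'cV[R]_n) : 0 <= \sum_i rmin * y i ord0 ^+ 2.
  by apply: sumr_ge0 => i _; rewrite mulr_ge0 ?sqr_ge0 ?(ltW rmin0).
split; rewrite ?rho1//.
- by move=> y _; rewrite subrr mulr0.
- by move=> y _; rewrite mul0r.
- exists (fun=> 0); first by rewrite pnorm0// mulr0.
  by move=> i; rewrite mxE subr0 normr0 divff ?gt_eqF// ln1 !mulr0.
Qed.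

Lemma irls_inv_gt0 r X N w i : irls_inv r X N w -> 0 < r i.
Proof. by case=> H _ _ _ _; apply: lt_le_trans (H i). Qed.

(** At [xs] the invariant bounds the energy from below and Hoelder from above; the gap between [M]
    and the norm of [xs] then limits [|r|_q]. *)
Lemma irls_inv_pnorm_le r X N w : irls_inv r X N w -> pnorm q r <= delta^-1.
Proof.
move=> I; have r0 i := irls_inv_gt0 i I; case: I => _ rho1 H _ _.
apply: (weight_norm_bound delta0 delta_half M0 _ xsM rho1); first exact: pnorm_ge0.
by apply: le_trans (energy_le_hoelder r0); exact: H.
Qed.

Lemma pnorm_target r (i0 : 'I_n) : (forall i, 0 < r i) ->
  pnorm p (target beta M r) = M.
Proof.
move=> r0; rewrite pnormZ// (gtr0_norm M0) -[RHS]mulr1; congr (_ * _).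
have rho0 := pnorm_gt0 beta0 r0 i0.
rewrite (@eq_pnorm _ _ p _ (fun i => `|r i / pnorm q r| `^ beta)); last first.
  by move=> i; rewrite ger0_norm// divr_ge0 ?(ltW (r0 i)) ?(ltW rho0).
rewrite (@pnorm_powR _ _ p beta (fun i => r i / pnorm q r) p0 beta0) pbeta.
rewrite (@eq_pnorm _ _ q _ (fun i => (pnorm q r)^-1 * r i)); last first.
  by move=> i; rewrite mulrC.
rewrite pnormZ// gtr0_norm ?invr_gt0//.
by rewrite mulVf ?powR1// gt_eqF.
Qed.

Section step.
Variables (r : 'I_n -> R) (X : 'cV[R]_n) (N w : nat) (phi : 'cV[R]_d).
Hypotheses (I : irls_inv r X N w) (phiP : solves A b (conductances r) phi).
Let x := wls_point r (A^T *m phi).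
Local Notation r' := (reweight beta M delta r x).
Local Notation al := (boost beta M delta r x).

Let r0 i : 0 < r i. Proof. exact: irls_inv_gt0 I. Qed.
Let al1 i : 1 <= al i. Proof. exact: boost_ge1. Qed.
Let al0 i : 0 < al i. Proof. by apply: lt_le_trans (al1 i). Qed.
Let rr' i : r i <= r' i. Proof. exact: le_reweight. Qed.
Let r'0 i : 0 < r' i. Proof. exact: reweight_gt0. Qed.

Let rmin_r' i : rmin <= r' i.
Proof. by case: I => H _ _ _ _; apply: le_trans (rr' i). Qed.

Let pnorm_r' : pnorm q r <= pnorm q r'.
Proof. by apply: le_pnorm => // i; rewrite !gtr0_norm. Qed.

(** A lower bound on the old energy holds in particular at its minimizer [x], to which the growth
    estimate adds. *)
Let energy_r' c y : A *m y = b ->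
  (forall z, A *m z = b -> c <= \sum_i r i * z i ord0 ^+ 2) ->
  c + \sum_i r i * x i ord0 ^+ 2 * (1 - (al i)^-1) <=
  \sum_i r' i * y i ord0 ^+ 2.
Proof.
move=> Ay H; apply: le_trans (wls_energy_growth r0 phiP al0 Ay).
by rewrite lerD2r; apply: H; exact: wls_point_feasible.
Qed.

Let norm_energy_r' y : A *m y = b ->
  M ^+ 2 * (pnorm q r' - 1) <= \sum_i r' i * y i ord0 ^+ 2.
Proof.
move=> Ay; case: I => _ _ H _ _; apply: le_trans (energy_r' Ay H).
apply: le_trans (lerD (lexx _) (pnorm_reweight_growth beta0 M0 delta0 x r0)).
move: (pnorm q r) (pnorm q r') => s s'.
by rewrite -mulrDr (_ : s - 1 + (s' - s) = s' - 1)//; ring.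
Qed.

Let coord_mono (z : R) i : z <= M * B * (r i `^ beta * ln (r i / rmin)) ->
  z <= M * B * (r' i `^ beta * ln (r' i / rmin)).
Proof.
move=> H; apply: le_trans H _.
have B0 : 0 <= B by rewrite addr_ge0// divr_ge0 ?mulr_ge0 ?ltW.
have ri1 : 1 <= r i / rmin.
  by rewrite ler_pdivlMr// mul1r; case: I => H _ _ _ _; exact: H.
rewrite ler_wpM2l ?mulr_ge0 ?(ltW M0)// ler_pM ?powR_ge0 ?ln_ge0//.
  by rewrite ler_powR2 ?(ltW (r0 i)) ?(ltW (r'0 i)).
by rewrite ler_ln ?posrE ?divr_gt0// ler_wpM2r// invr_ge0 ltW.
Qed.

(** The energy rises by [gain], because the boosted weight is at least [rmin] and the norm at most
    [1 / delta]. The coordinate bounds survive since they increase with the weights. *)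
Lemma irls_inv_bad i : S ^+ 2 < al i -> irls_inv r' X N w.+1.
Proof.
move=> Sal; have := irls_inv_pnorm_le I; case: (I) => Hmin rho1 _ Hw [Y HY XY] rhod.
split; [exact: rmin_r'|exact: le_trans rho1 pnorm_r'|exact: norm_energy_r'| |
  by exists Y; [exact: HY|move=> j; exact: coord_mono]].
move=> y Ay; apply: le_trans (energy_r' Ay Hw).
rewrite -natr1 mulrDl mul1r lerD2l.
have al2 : 2 <= al i by exact: le_trans (two_le_sqr S2) (ltW Sal).
apply: le_trans (boost_energy_large beta0 M0 delta0 r0 al2).
have rho0 : 0 < pnorm q r by apply: lt_le_trans rho1.
rewrite -[leLHS]mulrA -[leRHS]mulrA; apply: ler_wpM2l; first exact: sqr_ge0.
apply: ler_pM; rewrite ?mulr_ge0 ?powR_ge0 ?invr_ge0//.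
  rewrite -powRV ?(ltW rho0)// ler_powR2 ?subr_gt0 ?(ltW delta0) ?invr_ge0 ?(ltW rho0)//.
  by rewrite -[leLHS]invrK lef_pV2 ?posrE ?invr_gt0.
rewrite ler_wpM2r ?invr_ge0//; apply: ler_pM; rewrite ?powR_ge0//.
  by rewrite ler_powR2 ?(ltW rmin0) ?(ltW (r0 i)).
by rewrite ler_powR2 ?sqr_ge0 ?(ltW Sal) ?(ltW (al0 i)).
Qed.

(** Coordinates with boost 1 go to [Y], at a cost of [(1 + delta) M] in norm since the targets have
    norm [M]; any other is charged to the growth of [ln r_i]. *)
Lemma irls_inv_good : (forall i, al i <= S ^+ 2) -> irls_inv r' (X + x) N.+1 w.
Proof.
move=> alS; case: (I) => Hmin rho1 _ Hw [Y HY XY].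
split; [exact: rmin_r'|exact: le_trans rho1 pnorm_r'|exact: norm_energy_r'| |].
  move=> y Ay; apply: le_trans (energy_r' Ay Hw).
  rewrite lerDl; apply: sumr_ge0 => i _; exact: boost_energy_ge0.
pose z i := if al i == 1 then x i ord0 else 0.
have t0 i : 0 < target beta M r i := target_gt0 beta0 M0 r0 i.
exists (fun i => Y i + z i).
  apply: le_trans (pnormD _ _ p1) _.
  rewrite -natr1 mulrDr mulr1; apply: lerD => //.
  case: (pickP (fun i : 'I_n => true)) => [i0 _|no]; last first.
    rewrite (@eq_pnorm _ _ p z (fun=> 0)); last by move=> i; have := no i.
    by rewrite pnorm0// mulr_ge0 ?(ltW M0)// addr_ge0// ltW.
  have D0 : 0 <= 1 + delta by rewrite addr_ge0// ltW.
  apply: (@le_trans _ _ (pnorm p (fun i => (1 + delta) * target beta M r i)));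
    last by rewrite (pnormZ _ _ p0) (ger0_norm D0) (pnorm_target i0 r0).
  apply: (le_pnorm p0) => i.
  have Dt0 : 0 <= (1 + delta) * target beta M r i by exact: mulr_ge0 D0 (ltW (t0 i)).
  rewrite [leRHS](ger0_norm Dt0) /z.
  case: eqP => [|_]; last by rewrite normr0; exact: Dt0.
  case: (boost_coord beta0 M0 delta0 x r0 i rho1) => [[H _] _//|[H _] E].
  (* A boost equal to 1 excludes the large case, whose boosts are at least
     [(1 + delta)^(2/q) > 1]. *)
  have : (1 + delta) `^ 0 < (1 + delta) `^ (2 / q).
    by rewrite /powR gt_eqF ?ltr_wpDl ?ltr_expR ?ltr_pM2r ?divr_gt0// ?ln_gt0
      ?ltrDl// ltr_pwDl// ltW.
  by rewrite powRr0 => /lt_le_trans/(_ H); rewrite E ltxx.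
move=> i; rewrite mxE opprD addrACA.
have := boost_coord beta0 M0 delta0 x r0 i rho1; rewrite /z.
case: eqP => [_ _|/eqP alN1].
  by rewrite subrr addr0; apply: coord_mono; exact: XY.
case=> [[_ /eqP]|[lal xi]]; first by rewrite (negbTE alN1).
rewrite subr0; apply: le_trans (ler_normD _ _) _.
have B0 : 0 <= B by rewrite addr_ge0// divr_ge0 ?mulr_ge0 ?ltW.
(* The increase [ln (al i)] pays for the new excess through [sqrt_le_ln]. *)
have -> : ln (r' i / rmin) = ln (r i / rmin) + ln (al i).
  rewrite -lnM ?posrE ?divr_gt0//; congr ln; rewrite /reweight; ring.
rewrite [X in _ <= _ * X]mulrDr [leRHS]mulrDr; apply: lerD.
  apply: le_trans (XY i) _.
  rewrite ler_wpM2l ?mulr_ge0 ?(ltW M0)// ler_wpM2r//.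
    by rewrite ln_ge0// ler_pdivlMr// mul1r; exact: Hmin.
  by rewrite ler_powR2 ?(ltW (r0 i)) ?(ltW (r'0 i)).
apply: le_trans xi _.
rewrite -[leRHS]mulrA; apply: ler_wpM2l; first exact: ltW.
rewrite [leRHS]mulrCA; apply: ler_wpM2l; first exact: powR_ge0.
apply: sqrt_le_ln => //; first exact: ltW q1.
by rewrite delta0/=; apply: le_trans delta_half _; rewrite invf_le1// ler1n.
Qed.

End step.

(** The [w] gains fit below the energy at [xs], which is at most [M^2 / delta]. *)
Lemma irls_inv_bad_count r X N w : irls_inv r X N w ->
  w%:R <= 2 * n%:R * (delta `^ q * S `^ (2 * q))^-1.
Proof.
move=> I; have r0 i := irls_inv_gt0 i I; have := irls_inv_pnorm_le I.
case: I => _ rho1 _ /(_ _ Axs) H _ rhod.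
have := le_trans H (energy_le_hoelder r0).
have o0 : 0 <= lp_norm p xs by exact: pnorm_ge0.
have oM : lp_norm p xs <= M.
  by apply: le_trans xsM; rewrite ler_peMl// lerDl ltW.
move=> {}H; have {H} : w%:R * gain <= delta^-1 * M ^+ 2.
  apply: le_trans H (ler_pM (pnorm_ge0 _ _) (sqr_ge0 _) rhod _).
  rewrite ler_sqr ?nnegrE; [exact: oM|exact: o0|exact: ltW].
have -> : (S ^+ 2) `^ q = S `^ (2 * q) by rewrite -powR_mulrn// -powRrM.
rewrite powR_rmin -(mulr_powRB1 (ltW delta0) q0).
have D0 : 0 < delta `^ (q - 1) by rewrite powR_gt0.
have Sq0 : 0 < S `^ (2 * q) by rewrite powR_gt0// (lt_le_trans _ S2).
have nn0 : 0 < n%:R :> R by rewrite ltr0n.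
move: (delta `^ _) (S `^ _) D0 Sq0 => D Q D0 Q0 H.
have g0 : 0 < M ^+ 2 * D * (n%:R^-1 * Q / 2).
  by rewrite !mulr_gt0 ?invr_gt0// exprn_gt0.
rewrite -(ler_pM2r g0); apply: le_trans H _.
rewrite le_eqVlt; apply/orP; left; apply/eqP.
by field; rewrite !gt_eqF// ?mulr_gt0.
Qed.

(** In [X - Y], weights at most [1 / delta] bound every logarithm, and [|r^beta|_p = |r|_q^beta]
    because [p beta = q]. *)
Lemma irls_inv_norm_le r X N w : irls_inv r X N w ->
  lp_norm p X <= (1 + delta) * M * N%:R +
    M * (B * ln ((delta * rmin)^-1) * (delta `^ beta)^-1).
Proof.
move=> I; have r0 i := irls_inv_gt0 i I; have := irls_inv_pnorm_le I.
case: I => Hmin rho1 _ _ [Y HY XY] rhod.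
rewrite lp_normE (@eq_pnorm _ _ p _ (fun i => Y i + (X i ord0 - Y i))); last first.
  by move=> i; rewrite addrC subrK.
apply: le_trans (pnormD _ _ p1) _; apply: lerD => //.
have B0 : 0 <= B by rewrite addr_ge0// divr_ge0 ?mulr_ge0 ?ltW.
have L0 : 0 <= ln (delta * rmin)^-1.
  apply: ln_ge0; rewrite invf_ge1 ?mulr_gt0//.
  rewrite mulr_ile1 ?(ltW delta0) ?(ltW rmin0)//.
    by apply: le_trans delta_half _; rewrite invf_le1// ler1n.
  rewrite powRN invf_le1 ?powR_gt0 ?ltr0n//.
  have : (n%:R : R) `^ 0 <= n%:R `^ q^-1.
    by apply: ler_powR; rewrite ?ler1n// invr_ge0 ltW.
  by rewrite powRr0.
set C := M * (B * ln (delta * rmin)^-1).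
have C0 : 0 <= C by rewrite !mulr_ge0// ltW.
apply: (@le_trans _ _ (pnorm p (fun i => C * `|r i| `^ beta))).
  apply: le_pnorm => // i; apply: le_trans (XY i) _.
  have C1 : 0 <= C * `|r i| `^ beta by exact: mulr_ge0 C0 (powR_ge0 _ _).
  rewrite [leRHS](ger0_norm C1) (gtr0_norm (r0 i)) /C.
  rewrite [X in X * _ `^ _]mulrA -[leRHS]mulrA; apply: ler_wpM2l.
    exact: mulr_ge0 (ltW M0) B0.
  rewrite [leRHS]mulrC; apply: ler_wpM2l; first exact: powR_ge0.
  have ri : r i <= delta^-1.
    apply: le_trans rhod; rewrite -(gtr0_norm (r0 i)); exact: le_coord_pnorm.
  rewrite ler_ln ?posrE ?invr_gt0 ?mulr_gt0 ?invr_gt0//.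
  by rewrite invfM ler_wpM2r// invr_ge0 ltW.
rewrite pnormZ// (ger0_norm C0) (@pnorm_powR _ _ p beta r p0 beta0) pbeta.
rewrite mulrA ler_wpM2l// -powRV ?(ltW delta0)//.
by rewrite ler_powR2 ?pnorm_ge0 ?invr_ge0 ?(ltW delta0).
Qed.

End invariant.

(** * Programs *)

Section programs.
Variables (R : realType) (d n : nat) (p delta S : R) (K : nat).
Local Notation beta := ((p - 2)^-1).
Local Notation q := (1 + 2 * beta).
Local Notation rmin := (n%:R `^ (- q^-1)).

(** A discarded iterate still updates the weights. Each round makes exactly one call, so [k] is the
    number of calls whatever the answers. *)
Fixpoint irls (M : R) (k : nat) (r : 'I_n -> R) (X : 'cV[R]_n) (N : nat) :
    oracle_prog R d n ('cV[R]_n * nat) :=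
  if k is k'.+1 then
    Solve (conductances r) (fun _ g =>
      let x := wls_point r g in
      let r' := reweight beta M delta r x in
      if [forall i, boost beta M delta r x i <= S ^+ 2]
      then irls M k' r' (X + x) N.+1 else irls M k' r' X N)
  else Return R d n (X, N).

(** The geometric mean halves [ln (U / L)]. The guess may be too small, so the average is tested;
    for [K] large enough, a failed test certifies that [M] is below [1 + delta] times the
    optimum. *)
Fixpoint bisection (k : nat) (L U : R) (x : 'cV[R]_n) : iter_alg R d n :=
  if k is k'.+1 then
    let M := Num.sqrt (L * U) in
    Subproblem (irls M K (fun=> rmin) 0 0) (fun s =>
      let y := s.2%:R^-1 *: s.1 in
      if (0 < s.2)%N && (lp_norm p y <= (1 + 2 * delta) * M)
      then bisection k' L M y else bisection k' M U x)
  else Output d x.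

Variables (A : 'M[R]_(d, n)) (b : 'cV[R]_d) (solver : 'rV[R]_n -> 'cV[R]_d).
Hypotheses (p2 : 2 < p) (delta0 : 0 < delta) (delta_half : delta <= 2^-1).
Hypotheses (S2 : 2 <= S) (feas : exists x0, A *m x0 = b).
Hypothesis solverP : is_solver A b solver.

Let beta0 : 0 < beta. Proof. by rewrite invr_gt0 subr_gt0. Qed.

Lemma valid_conductances r : (forall i, 0 < r i) ->
  valid_call A b (conductances r).
Proof.
by move=> r0; apply: valid_call_gt0 => // i; rewrite mxE invr_gt0.
Qed.

(** Feasibility and validity of the calls hold for every positive guess, the invariant only for one
    that is large enough, hence the inner hypothesis. Each call is kept or discarded, whence the
    final count. *)
Lemma run_irls (M : R) k r X N : 0 < M -> (forall i, 0 < r i) ->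
  A *m X = N%:R *: b ->
  let s := run_prog A solver (irls M k r X N) in
  [/\ size s.2 = k, forall D, D \in s.2 -> valid_call A b D,
      A *m s.1.1 = s.1.2%:R *: b &
      forall (xs : 'cV[R]_n) (w : nat), (0 < n)%N -> A *m xs = b ->
        (1 + delta) * lp_norm p xs <= M -> irls_inv A b p M delta S r X N w ->
        exists r' w', irls_inv A b p M delta S r' s.1.1 s.1.2 w' /\
          (s.1.2 + w' = N + w + k)%N].
Proof.
move=> M0; elim: k r X N => [|k IH] r X N r0 AX.
  split=> // xs w _ _ _ I; exists r, w; split; first exact: I.
  by rewrite addn0.
have vD := valid_conductances r0; have phiP := solverP vD.
set phi := solver (conductances r) in phiP.
set x := wls_point r (A^T *m phi).
have Ax : A *m x = b by exact: wls_point_feasible.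
have r'0 i : 0 < reweight beta M delta r x i by exact: reweight_gt0.
have in_calls (D : 'rV[R]_n) (t : seq 'rV[R]_n) :
    (forall D, D \in t -> valid_call A b D) ->
    D \in conductances r :: t -> valid_call A b D.
  by move=> H; rewrite inE => /orP[/eqP->//|]; exact: H.
rewrite /= -/phi -/x.
case: ifPn => [/forallP alS|].
  have AXx : A *m (X + x) = N.+1%:R *: b.
    by rewrite mulmxDr AX Ax -natr1 scalerDl scale1r.
  have [szk vk Ak Ik] := IH _ _ _ r'0 AXx.
  split; [by rewrite /= szk|by move=> D; exact: in_calls|exact: Ak|].
  move=> xs w n0 Axs xsM I.
  have I' := irls_inv_good p2 n0 M0 delta0 delta_half S2 I phiP alS.
  have [r' [w' [Hi Hn]]] := Ik xs w n0 Axs xsM I'.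
  exists r', w'; split; first exact: Hi.
  by rewrite Hn addSn addSn addnS.
rewrite negb_forall => /existsP[i]; rewrite -ltNge => Sal.
have [szk vk Ak Ik] := IH _ _ _ r'0 AX.
split; [by rewrite /= szk|by move=> D; exact: in_calls|exact: Ak|].
move=> xs w n0 Axs xsM I.
have I' := irls_inv_bad p2 n0 M0 delta0 delta_half S2 Axs xsM I phiP Sal.
have [r' [w' [Hi Hn]]] := Ik xs w.+1 n0 Axs xsM I'.
exists r', w'; split; first exact: Hi.
by rewrite Hn addnS addSnnS.
Qed.

(** After [Tgood] kept iterates the averaged deviation from [Y] is at most [delta * M]; [Wbad]
    bounds the discarded ones. Beyond the sum of both, enough iterates are kept. *)
Local Notation Tgood := ((2 * q / delta + S) * ln (delta * rmin)^-1 *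
  (delta `^ beta)^-1 / delta).
Local Notation Wbad := (2 * n%:R * (delta `^ q * S `^ (2 * q))^-1).
Hypotheses (n0 : (0 < n)%N) (Tgood0 : 0 <= Tgood) (KP : Tgood + Wbad < K%:R).

Lemma irls_norm_le (M : R) (xs : 'cV[R]_n) : 0 < M -> A *m xs = b ->
  (1 + delta) * lp_norm p xs <= M ->
  let s := (run_prog A solver (irls M K (fun=> rmin) 0 0)).1 in
  (0 < s.2)%N /\ lp_norm p (s.2%:R^-1 *: s.1) <= (1 + 2 * delta) * M.
Proof.
move=> M0 Axs xsM /=.
have rmin0 : 0 < rmin by rewrite powR_gt0// ltr0n.
have A0 : A *m (0 : 'cV[R]_n) = 0%N%:R *: b by rewrite mulmx0 scale0r.
have [_ _ _ H] := run_irls K M0 (fun=> rmin0) A0.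
have [r [w [I NwK]]] := H xs 0%N n0 Axs xsM (irls_inv_init A b M delta S p2 n0).
move: I NwK; set s := (run_prog _ _ _).1; rewrite !add0n.
move: s.1 s.2 => X N I NwK.
have wW := irls_inv_bad_count p2 n0 M0 delta0 delta_half S2 Axs xsM I.
have TN : Tgood < N%:R.
  rewrite -(ltrD2r Wbad); apply: lt_le_trans KP _.
  by rewrite -NwK natrD lerD2l.
have N0 : 0 < N%:R :> R by apply: le_lt_trans TN.
split; first by rewrite -(ltr0n R).
have p0 : 0 < p by apply: lt_trans p2.
have -> : lp_norm p (N%:R^-1 *: X) = N%:R^-1 * lp_norm p X.
  rewrite !lp_normE (@eq_pnorm _ _ p _ (fun i => N%:R^-1 * X i ord0)).
    by rewrite (pnormZ _ _ p0) gtr0_norm// invr_gt0.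
  by move=> i; rewrite mxE.
rewrite mulrC ler_pdivrMr//.
apply: le_trans (irls_inv_norm_le p2 n0 M0 delta0 delta_half S2 Axs xsM I) _.
move: TN; rewrite ltr_pdivrMr// => /ltW TN.
apply: le_trans (lerD (lexx _) (ler_wpM2l (ltW M0) TN)) _.
by rewrite le_eqVlt; apply/orP; left; apply/eqP; ring.
Qed.

(** Each round takes the square root of [U / L], so [t], a [2^k]-th root of the initial ratio, is
    the final one. *)
Lemma run_bisection (xs : 'cV[R]_n) k (L U : R) x : A *m xs = b ->
  0 < L -> L <= U -> L <= (1 + delta) * lp_norm p xs ->
  A *m x = b -> lp_norm p x <= (1 + 2 * delta) * U ->
  let a := run_alg A solver (bisection k L U x) in
  [/\ A *m a.1 = b,
      exists t : R, [/\ 0 <= t, t ^+ (2 ^ k) = U / L &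
        lp_norm p a.1 <= (1 + 2 * delta) * (t * ((1 + delta) * lp_norm p xs))],
      size a.2 = k &
      forall c, c \in a.2 -> size c = K /\ forall D, D \in c -> valid_call A b D].
Proof.
move=> Axs; elim: k L U x => [|k IH] L U x L0 LU Lo Ax xU.
  split=> //; exists (U / L); split.
  - by rewrite divr_ge0 ?(le_trans (ltW L0) LU) ?(ltW L0).
  - by rewrite expr1.
  have U0 : 0 <= U / L by rewrite divr_ge0 ?(le_trans (ltW L0) LU) ?(ltW L0).
  apply: le_trans xU _; apply: ler_wpM2l; first by rewrite addr_ge0// mulr_ge0// ltW.
  apply: le_trans (ler_wpM2l U0 Lo).
  by rewrite divfK ?gt_eqF.
have U0 : 0 < U by apply: lt_le_trans LU.
rewrite /=; set M := Num.sqrt (L * U).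
have M2 : M ^+ 2 = L * U by rewrite sqr_sqrtr// ltW// mulr_gt0.
have M0 : 0 < M by rewrite sqrtr_gt0 mulr_gt0.
have LM : L <= M by
  rewrite -ler_sqr ?nnegrE ?(ltW L0) ?(ltW M0)// M2 expr2 ler_wpM2l// ltW.
have MU : M <= U by
  rewrite -ler_sqr ?nnegrE ?(ltW U0) ?(ltW M0)// M2 expr2 ler_wpM2r// ltW.
have rmin0 : 0 < rmin by rewrite powR_gt0// ltr0n.
have A0 : A *m (0 : 'cV[R]_n) = 0%N%:R *: b by rewrite mulmx0 scale0r.
have := run_irls K M0 (fun=> rmin0) A0.
have := fun xsM => irls_norm_le M0 Axs xsM.
move: (run_prog _ _ _) => s /= HM [szK vK As _].
have in_calls (l : seq (seq 'rV[R]_n)) :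
    (forall c, c \in l -> size c = K /\ forall D, D \in c -> valid_call A b D) ->
    forall c, c \in s.2 :: l ->
      size c = K /\ forall D, D \in c -> valid_call A b D.
  by move=> H c; rewrite inE => /orP[/eqP->|/H].
case: ifPn => [/andP[N0 yM]|Hn].
  have Ay : A *m (s.1.2%:R^-1 *: s.1.1) = b.
    by rewrite -scalemxAr As scalerA mulVf ?scale1r// pnatr_eq0 -lt0n.
  have [Aa [t [t0 tE ta]] sza va] := IH L M _ L0 LM Lo Ay yM.
  split; [exact: Aa| |by rewrite /= sza|exact: in_calls].
  exists t; split; [exact: t0| |exact: ta].
  rewrite expnSr exprM tE expr_div_n M2.
  by field; rewrite gt_eqF.
(* Contraposition of [irls_norm_le] makes [M] a legitimate lower end. *)
have Mo : M <= (1 + delta) * lp_norm p xs.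
  have /orP[//|oM] := le_total M ((1 + delta) * lp_norm p xs).
  by have [N0 yM] := HM oM; move: Hn; rewrite N0 yM.
have [Aa [t [t0 tE ta]] sza va] := IH M U x M0 MU Mo Ax xU.
split; [exact: Aa| |by rewrite /= sza|exact: in_calls].
exists t; split; [exact: t0| |exact: ta].
rewrite expnSr exprM tE expr_div_n M2.
by field; rewrite !gt_eqF.
Qed.

End programs.

(** * Parameters and call counts *)

Section parameters.
Variables (R : realType) (p : R).
Local Notation beta := ((p - 2)^-1).
Local Notation q := (1 + 2 * beta).
Implicit Types (n : nat) (delta eps : R).

(* The width equates the two step counts below, up to constants and logarithms. *)
Definition width n delta : R :=
  2 + n%:R `^ (2 * q + 1)^-1 * (delta `^ (beta / (2 * q + 1)))^-1.

Definition good_steps n delta : R :=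
  (2 * q / delta + width n delta) * ln (delta * n%:R `^ (- q^-1))^-1 *
  (delta `^ beta)^-1 / delta.

Definition bad_steps n delta : R :=
  2 * n%:R * (delta `^ q * width n delta `^ (2 * q))^-1.

Definition irls_steps n delta : nat :=
  (Num.truncn (good_steps n delta + bad_steps n delta)).+1.

Definition bisection_steps n delta : nat :=
  (Num.truncn (ln (4 * ln n%:R / delta) / ln 2)).+1.

(** Keeps [ln (ln n)] away from 0 for [n >= 3]. From [ln (7/8) <= -1/8] follows [ln (8/7) >= 1/8],
    and [(8/7)^8 < 3]. *)
Lemma ln3_gt1 : 1 < ln 3%:R :> R.
Proof.
have e0 : 0 < (8%:R / 7%:R : R) by rewrite divr_gt0.
have : ln ((8%:R / 7%:R : R) ^+ 8) < ln 3%:R.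
  rewrite ltr_ln ?posrE ?exprn_gt0// expr_div_n ltr_pdivrMr ?exprn_gt0//.
  lra.
apply: le_lt_trans; rewrite lnXn//.
have := @le_ln1Dx R (- (8%:R)^-1).
have -> : 1 + - (8%:R)^-1 = (8%:R / 7%:R)^-1 :> R by rewrite invf_div; lra.
rewrite lnV ?posrE// ltrN2 invf_lt1// ltr1n => /(_ isT).
rewrite lerN2 => H; rewrite -[leRHS]mulr_natl.
by apply: le_trans (ler_wpM2l _ H); rewrite ?mulfV ?pnatr_eq0.
Qed.

Lemma ln_ge3 n : (3 <= n)%N -> ln 3%:R <= ln n%:R :> R.
Proof. by move=> n3; rewrite ler_ln ?posrE ?ltr0n ?ler_nat// (leq_trans _ n3). Qed.

Lemma ln2_ge_half : 2^-1 <= ln 2 :> R.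
Proof.
have := @ln1D_ge R 1; rewrite ler01 lexx => /(_ isT).
by rewrite -[1 + 1]/(2%:R) div1r.
Qed.

(** Here [n^2] is the initial ratio of the bisection. As [ln (1 + delta) >= delta / 2], it suffices
    that [2^k >= 4 ln n / delta]. *)
Lemma bisection_steps_ge n delta : (0 < n)%N -> 0 < delta <= 1 ->
  (n%:R ^+ 2 : R) <= (1 + delta) ^+ (2 ^ bisection_steps n delta).
Proof.
move=> n0 /andP[d0 d1]; set k := bisection_steps n delta.
have D0 : 0 < 1 + delta by rewrite addr_gt0.
have nn0 : 0 < n%:R :> R by rewrite ltr0n.
rewrite -ler_ln ?posrE ?exprn_gt0// !lnXn// -[leLHS]mulr_natl -[leRHS]mulr_natl.
rewrite natrX.
have H : 4 * ln n%:R / delta <= 2 ^+ k.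
  have [X0|X0] := leP (4 * ln n%:R / delta) 0.
    by apply: le_trans X0 _; rewrite exprn_ge0.
  rewrite -ler_ln ?posrE ?exprn_gt0// lnXn// -[leRHS]mulr_natl.
  have l20 : 0 < ln 2 :> R by apply: lt_le_trans ln2_ge_half; rewrite invr_gt0.
  by rewrite -ler_pdivrMr//; apply/ltW/truncnS_gt.
have := @ln1D_ge R delta; rewrite d1 (ltW d0) => /(_ isT) H2.
apply: le_trans (ler_wpM2l (exprn_ge0 _ _) H2) => //.
apply: le_trans (ler_wpM2r _ H); last by rewrite divr_ge0// ltW.
by rewrite le_eqVlt; apply/orP; left; apply/eqP; field; rewrite gt_eqF.
Qed.

(** 28 is the 4 of [bisection_steps] times the 7 of [delta = eps / 7]. Dividing by [ln (ln 3)], a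
    lower bound of [subproblem_bound], absorbs additive constants. *)
Definition subproblem_const : R := (2 + 2 * ln 28%:R) / ln (ln 3%:R) + 2.

Lemma lnln3_gt0 : 0 < ln (ln 3%:R) :> R.
Proof. exact: ln_gt0 ln3_gt1. Qed.

Lemma subproblem_const_gt0 : 0 < subproblem_const.
Proof.
apply: ltr_wpDl => //; apply: divr_ge0; last exact: ltW lnln3_gt0.
by rewrite addr_ge0// mulr_ge0// ln_ge0// ler1n.
Qed.

(** The successor counts the least squares subproblem that starts the algorithm. *)
Lemma bisection_steps_le n eps : (3 <= n)%N -> 0 < eps <= 1 ->
  (bisection_steps n (eps / 7)).+1%:R <= subproblem_const * subproblem_bound n eps.
Proof.
move=> n3 /andP[e0 e1]; rewrite /bisection_steps /subproblem_bound.
have l1 : 1 < ln n%:R :> R by apply: lt_le_trans ln3_gt1 (ln_ge3 n3).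
have l0 : 0 < ln n%:R :> R by apply: lt_trans l1.
have ie : 1 <= 1 / eps by rewrite ler_pdivlMr// mul1r.
have -> : 4 * ln n%:R / (eps / 7) = 28%:R * (ln n%:R * (1 / eps)).
  by field; rewrite gt_eqF.
have LL : ln (ln 3%:R) <= ln (ln n%:R) :> R.
  by rewrite ler_ln ?posrE ?ln_ge3// (lt_trans ltr01 ln3_gt1).
have i0 : 0 < 1 / eps by apply: lt_le_trans ie.
have lnX (u : R) : 0 < u ->
    ln (28%:R * (ln n%:R * u)) = ln 28%:R + (ln (ln n%:R) + ln u).
  by move=> u0; rewrite lnM ?posrE ?mulr_gt0// lnM.
rewrite (lnX _ i0).
have L1 : 0 <= ln (1 / eps) by rewrite ln_ge0.
have L28 : 0 <= ln 28%:R :> R by rewrite ln_ge0// ler1n.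
have c0 := lnln3_gt0.
have sb0 : ln (ln 3%:R) <= ln (ln n%:R) + ln (1 / eps) by rewrite -[leLHS]addr0 lerD.
rewrite /subproblem_const.
move: (ln (ln n%:R) + ln (1 / eps)) (ln (ln 3%:R)) c0 sb0 => t c c0 ct.
have t0 : 0 <= t by apply: le_trans ct; exact: ltW.
have l2 := ln2_ge_half.
have l20 : 0 < ln 2 :> R by apply: lt_le_trans l2; rewrite invr_gt0.
set z := (_ / ln 2).
have z0 : 0 <= z by rewrite divr_ge0 ?addr_ge0 ?(ltW l20).
have z2 : z <= 2 * (ln 28%:R + t).
  rewrite ler_pdivrMr// mulrC mulrA ler_peMl ?addr_ge0//; lra.
have tz : (Num.truncn z)%:R <= z by rewrite truncn_le.
rewrite -2!natr1 mulrDl.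
have : 2 + 2 * ln 28%:R <= (2 + 2 * ln 28%:R) / c * t.
  rewrite mulrAC -mulrA ler_peMr ?addr_ge0 ?mulr_ge0//.
  by rewrite ler_pdivlMr// mul1r.
move: (ln 28%:R) tz z2 ((2 + _) / c * t) L28 => l tz z2 m L28; lra.
Qed.

(** Covers the single call of the starting subproblem, also for [p = 2], where division by 0 turns
    exponents into 0. *)
Lemma call_bound_ge1 n eps : 2 <= p -> (3 <= n)%N -> 0 < eps <= 1 ->
  1 <= call_bound p n eps.
Proof.
move=> p2 n3 /andP[e0 e1]; rewrite /call_bound.
have ie : 1 <= 1 / eps by rewrite ler_pdivlMr// mul1r.
have pw (x : R) : 0 <= x -> 1 <= (1 / eps) `^ x.
  by move=> x0; have := ler_powR ie x0; rewrite powRr0.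
rewrite -[leLHS]mulr1; apply: ler_pM => //.
  rewrite -[leLHS]addr0 lerD ?mulr_ge0 ?powR_ge0// pw// divr_ge0//; lra.
apply: le_trans (ltW ln3_gt1) _; apply: le_trans (ln_ge3 n3) _.
have nn0 : 0 < n%:R :> R by rewrite ltr0n (leq_trans _ n3).
rewrite ler_ln ?posrE ?divr_gt0 ?powR_gt0// ler_pdivlMr ?powR_gt0//.
rewrite ler_piMr// ?ler0n//.
have x0 : 0 <= p / (p - 2) by rewrite divr_ge0//; lra.
have : eps `^ (p / (p - 2)) <= eps `^ 0 by apply: ger_powR => //; rewrite e0.
by rewrite powRr0.
Qed.

(** The power of 7 pays for [1 / delta = 7 / eps], as [3 + 2 * beta] dominates the exponents of
    [1 / eps]; the rest comes from [steps_arith]. *)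
Definition call_const : R := 7%:R `^ (3 + 2 * beta) * ((2 * q + 3) * (ln 7%:R + 1)).

Hypothesis p2 : 2 < p.

Let pB2 : 0 < p - 2. Proof. by rewrite subr_gt0. Qed.
Let beta0 : 0 < beta. Proof. by rewrite invr_gt0. Qed.
Let q0 : 0 < q. Proof. by rewrite addr_gt0// mulr_gt0. Qed.
Let p32 : 0 < 3 * p - 2. Proof. by move: p2; lra. Qed.
Let a0 : 0 < 2 * q + 1. Proof. by rewrite addr_gt0// mulr_gt0. Qed.

Lemma width_ge2 n delta : 2 <= width n delta.
Proof. by rewrite lerDl mulr_ge0 ?invr_ge0 ?powR_ge0. Qed.

(** With [s] equal to [width - 2], [s^(2q+1) = n delta^(-beta)], so
    [n delta^(-q) = s delta^(-1-beta) s^(2q)]; the last factor is at most [width^(2q)]. *)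
Lemma bad_steps_le n delta (s := n%:R `^ (2 * q + 1)^-1 *
    delta^-1 `^ (beta / (2 * q + 1))) : (0 < n)%N -> 0 < delta ->
  bad_steps n delta <= 2 * (s * delta^-1 `^ (1 + beta)).
Proof.
move=> n0 d0; have nn0 : 0 < n%:R :> R by rewrite ltr0n.
have v0 : 0 < delta^-1 by rewrite invr_gt0.
have s0 : 0 < s by rewrite mulr_gt0 ?powR_gt0.
have SE : width n delta = 2 + s by rewrite /width -powRV ?(ltW d0).
rewrite /bad_steps SE invfM -powRV ?(ltW d0)// -mulrA ler_wpM2l//.
rewrite !mulrA ler_pdivrMr ?powR_gt0 ?addr_gt0//.
have sE : s `^ (2 * q + 1) = n%:R * delta^-1 `^ beta.
  rewrite powRM ?powR_ge0// -!powRrM mulVf ?gt_eqF// powRr1 ?(ltW nn0)//.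
  by rewrite divfK ?gt_eqF.
have -> : n%:R * delta^-1 `^ q = s * delta^-1 `^ (1 + beta) * s `^ (2 * q).
  have -> : s * delta^-1 `^ (1 + beta) * s `^ (2 * q) =
      s `^ (2 * q + 1) * delta^-1 `^ (1 + beta).
    rewrite (@powRD _ s (2 * q) 1); last by rewrite (gt_eqF s0) implybT.
    by rewrite (powRr1 (ltW s0)); ring.
  rewrite sE -mulrA -powRD; last by rewrite (gt_eqF v0) implybT.
  by congr (_ * _ `^ _); ring.
rewrite ler_wpM2l ?mulr_ge0 ?powR_ge0 ?(ltW s0)//.
by rewrite ler_powR2 ?mulr_gt0 ?addr_ge0 ?(ltW s0)// lerDr.
Qed.

Lemma ln_invr_min n delta : (0 < n)%N -> 0 < delta ->
  ln (delta * n%:R `^ (- q^-1))^-1 = ln delta^-1 + ln n%:R / q.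
Proof.
move=> n0 d0; have nn0 : 0 < n%:R :> R by rewrite ltr0n.
rewrite invfM lnM ?posrE ?invr_gt0 ?powR_gt0//; congr (_ + _).
by rewrite -powRN opprK ln_powR mulrC.
Qed.

Lemma good_steps_ge0 n delta : (0 < n)%N -> 0 < delta <= 1 ->
  0 <= good_steps n delta.
Proof.
move=> n0 /andP[d0 d1]; rewrite /good_steps ln_invr_min//.
have w2 := width_ge2 n delta.
apply: divr_ge0; last exact: ltW.
apply: mulr_ge0; last by rewrite invr_ge0 powR_ge0.
apply: mulr_ge0.
  rewrite addr_ge0 ?(le_trans _ w2)// divr_ge0 ?mulr_ge0 ?(ltW q0) ?(ltW d0)//.
by rewrite addr_ge0 ?divr_ge0 ?ln_ge0 ?ler1n ?(ltW q0)// invf_ge1.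
Qed.

(** Used with [v = 1 / delta], [s = width - 2], [P = delta^(-1-beta)], and [La], [L] the logarithms
    in the step count and in the claimed bound. *)
Lemma steps_arith (q' v s P La L l : R) : 0 <= q' -> 1 <= v -> 0 <= s -> 1 <= P ->
  0 <= La -> La <= l * L -> 1 <= L -> 1 <= l ->
  (2 * q' * v + (2 + s)) * La * P + 2 * (s * P) + 1 <=
  (2 * q' + 3) * l * ((v * P + s * P) * L).
Proof.
move=> q'0 v1 s0 P1 La0 LaL L1 l1.
have lL1 : 1 <= l * L by nra.
have P0 : 0 <= P by lra.
have sP0 : 0 <= s * P by rewrite mulr_ge0.
have vP1 : 1 <= v * P by nra.
have H1 : (2 * q' * v + (2 + s)) * La * P <=
    ((2 * q' + 2) * (v * P) + s * P) * (l * L).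
  apply: (@le_trans _ _ (((2 * q' + 2) * v + s) * (l * L) * P)).
    apply: ler_wpM2r => //; apply: ler_pM => //; last by nra.
    by have := mulr_ge0 q'0 (le_trans ler01 v1); lra.
  by rewrite le_eqVlt; apply/orP; left; apply/eqP; ring.
have H2 : 2 * (s * P) <= 2 * (s * P) * (l * L) by rewrite ler_peMr// mulr_ge0.
have H3 : 1 <= v * P * (l * L) by nra.
have H4 : 0 <= q' * (s * P) * (l * L).
  by rewrite !mulr_ge0//; lra.
have -> : (2 * q' + 3) * l * ((v * P + s * P) * L) =
  ((2 * q' + 2) * (v * P) + s * P) * (l * L) + 2 * (s * P) * (l * L) +
  v * P * (l * L) + 2 * (q' * (s * P) * (l * L)) by ring.
lra.
Qed.

(** The dominant terms are [P / delta] and [s * P]. The claimed exponents are theirs: [2 + beta],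
    and [1 / (2q+1)] for [n] with [beta / (2q+1) + 1 + beta] for [1 / eps]. *)
Lemma irls_steps_le n eps : (3 <= n)%N -> 0 < eps <= 1 ->
  (irls_steps n (eps / 7))%:R <= call_const * call_bound p n eps.
Proof.
move=> n3 /andP[e0 e1]; set delta := eps / 7.
have n0 : (0 < n)%N by apply: leq_trans n3.
have nn0 : 0 < n%:R :> R by rewrite ltr0n.
have d0 : 0 < delta by rewrite divr_gt0.
have d1 : delta <= 1 by rewrite ler_pdivrMr// mul1r (le_trans e1)// ler1n.
have i1 : 1 <= 1 / eps by rewrite ler_pdivlMr// mul1r.
have i0 : 0 < 1 / eps by apply: lt_le_trans i1.
have vE : delta^-1 = 7%:R * (1 / eps) by rewrite invf_div mulrA mulr1.
have v1 : 1 <= delta^-1 by rewrite invf_ge1.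
have v0 : 0 < delta^-1 by rewrite invr_gt0.
set s := n%:R `^ (2 * q + 1)^-1 * delta^-1 `^ (beta / (2 * q + 1)).
have s0 : 0 <= s by rewrite mulr_ge0 ?powR_ge0.
set L := ln (n%:R / eps `^ (p / (p - 2))).
have qE : p / (p - 2) = q by field; rewrite gt_eqF.
have LE : L = ln n%:R + q * ln (1 / eps).
  rewrite /L qE ln_div ?posrE ?powR_gt0// ln_powR -mulrN; congr (_ + _ * _).
  by rewrite div1r lnV.
have L0 : 0 <= ln (1 / eps) by rewrite ln_ge0.
have L1 : 1 <= L.
  rewrite LE -[leLHS]addr0 lerD// ?mulr_ge0 ?(ltW q0)//.
  exact: le_trans (ltW ln3_gt1) (ln_ge3 n3).
have l70 : 0 <= ln 7%:R :> R by rewrite ln_ge0// ler1n.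
set La := ln delta^-1 + ln n%:R / q.
have LaE : La = ln 7%:R + L / q.
  have gen (a b c t : R) : t != 0 -> a + b + c / t = a + (c + t * b) / t.
    by move=> t0; field.
  by rewrite /La vE LE lnM ?posrE// gen// gt_eqF.
have La0 : 0 <= La.
  by rewrite LaE addr_ge0// divr_ge0 ?(ltW q0)// (le_trans ler01 L1).
have LaL : La <= (ln 7%:R + 1) * L.
  rewrite LaE [leRHS]mulrDl [X in _ <= _ + X]mul1r.
  apply: lerD; first by rewrite ler_peMr.
  rewrite ler_pdivrMr// ler_peMr ?(le_trans ler01 L1)//.
  by rewrite lerDl mulr_ge0// ltW.
set P := delta^-1 `^ (1 + beta).
have P1 : 1 <= P.
  have : delta^-1 `^ 0 <= P by apply: ler_powR => //; rewrite addr_ge0// ltW.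
  by rewrite powRr0.
have TE : good_steps n delta = (2 * q * delta^-1 + (2 + s)) * La * P.
  rewrite /good_steps ln_invr_min// -/La /width -!powRV ?(ltW d0)// -/s.
  rewrite -!mulrA; congr (_ * (_ * _)).
  rewrite /P powRD; last by rewrite (gt_eqF v0) implybT.
  by rewrite powRr1 ?(ltW v0)// mulrC.
apply: (@le_trans _ _ (good_steps n delta + bad_steps n delta + 1)).
  rewrite -natr1 lerD2r truncn_le// addr_ge0//.
    by rewrite good_steps_ge0// d0.
  by rewrite !mulr_ge0// invr_ge0 mulr_ge0 ?powR_ge0.
apply: (@le_trans _ _ ((2 * q + 3) * (ln 7%:R + 1) *
    ((delta^-1 * P + s * P) * L))).
  apply: le_trans (steps_arith (ltW q0) v1 s0 P1 La0 LaL L1 _); last first.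
    by rewrite lerDr.
  by rewrite TE lerD2r lerD2l; exact: bad_steps_le.
rewrite /call_const /call_bound -/L.
set E1 := (1 / eps) `^ _; set E2 := (_ * (1 / eps) `^ _).
have v7 (x : R) : x <= 3 + 2 * beta ->
    delta^-1 `^ x <= 7%:R `^ (3 + 2 * beta) * (1 / eps) `^ x.
  move=> x3; rewrite vE powRM// ?(ltW i0)//; apply: ler_wpM2r; first exact: powR_ge0.
  by apply: ler_powR => //; rewrite ler1n.
have H : delta^-1 * P + s * P <= 7%:R `^ (3 + 2 * beta) * (E1 + E2).
  rewrite [leRHS]mulrDr; apply: lerD.
    have -> : delta^-1 * P = delta^-1 `^ (2 + beta).
      rewrite (_ : 2 + beta = 1 + (1 + beta)); last by ring.
      rewrite [RHS]powRD ?(powRr1 (ltW v0))//.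
      by rewrite (gt_eqF v0) implybT.
    rewrite /E1 (_ : (2 * p - 3) / (p - 2) = 2 + beta); last first.
      by field; rewrite gt_eqF.
    by apply: v7; have := ltW beta0; lra.
  rewrite /s /P -mulrA -powRD; last by rewrite (gt_eqF v0) implybT.
  rewrite /E2 mulrCA.
  rewrite (_ : (2 * q + 1)^-1 = (p - 2) / (3 * p - 2)); last first.
    by field; rewrite !gt_eqF//=; have := a0; lra.
  apply: ler_wpM2l; first exact: powR_ge0.
  rewrite (_ : (3 * p ^+ 2 - 4 * p) / (3 * p ^+ 2 - 8 * p + 4) =
      beta * ((p - 2) / (3 * p - 2)) + (1 + beta)).
    apply: v7; rewrite mulrA mulVf ?gt_eqF// mul1r.
    have := ltW beta0.
    have : (3 * p - 2)^-1 <= 1 by rewrite invf_le1//; move: p2; lra.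
    lra.
  have -> : 3 * p ^+ 2 - 8 * p + 4 = (p - 2) * (3 * p - 2) by ring.
  by field; rewrite !gt_eqF.
rewrite (_ : _ * _ * ((E1 + E2) * L) = (2 * q + 3) * (ln 7%:R + 1) *
  (7%:R `^ (3 + 2 * beta) * (E1 + E2) * L)); last by ring.
apply: ler_wpM2l; first by rewrite mulr_ge0 ?addr_ge0 ?mulr_ge0 ?(ltW q0).
by apply: ler_wpM2r H; exact: le_trans ler01 L1.
Qed.

End parameters.

(** * The algorithm and its guarantee *)

Section regression.
Variables (R : realType) (p : R).

(** Unit weights give the least squares point, optimal if [p = 2] or its norm is 0. The 7 comes from
    [accuracy_product]; the minimum keeps [delta] small when [eps] is large. *)
Definition lp_regression (d n : nat) (eps : R) : iter_alg R d n :=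
  let delta := Num.min eps 1 / 7 in
  Subproblem
    (Solve (conductances (fun=> 1)) (fun _ g =>
       Return R d n (wls_point (fun=> 1) g)))
    (fun x0 =>
       let U := lp_norm p x0 in
       if (p == 2) || (U == 0) then Output d x0
       else bisection d p delta (width p n delta) (irls_steps p n delta)
              (bisection_steps n delta) (U / n%:R ^+ 2) U x0).

Lemma le_sum_sqr_optimal n (xs : 'cV[R]_n) : 0 < p ->
  \sum_i xs i ord0 ^+ 2 <= n%:R * lp_norm p xs ^+ 2.
Proof.
move=> p0; apply: (@le_trans _ _ (\sum_(i < n) lp_norm p xs ^+ 2)).
  apply: ler_sum => i _; rewrite -[leLHS]real_normK ?num_real//.
  rewrite ler_sqr ?nnegrE; [|exact: normr_ge0|exact: pnorm_ge0].
  exact: (le_coord_pnorm (fun i => xs i ord0)).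
by rewrite sumr_const card_ord -[leLHS]mulr_natl.
Qed.

(** Coordinates of [x] are at most its Euclidean norm, hence that of [xs], hence [n |xs|_p];
    [pnorm_le_max] adds the second [n]. *)
Lemma l2_point_bound n (x xs : 'cV[R]_n) : 1 <= p ->
  \sum_i x i ord0 ^+ 2 <= \sum_i xs i ord0 ^+ 2 ->
  lp_norm p x <= n%:R ^+ 2 * lp_norm p xs.
Proof.
move=> p1 H; have p0 : 0 < p by apply: lt_le_trans p1.
have o0 : 0 <= lp_norm p xs by exact: pnorm_ge0.
have no0 : 0 <= n%:R * lp_norm p xs by exact: mulr_ge0 (ler0n _ _) o0.
rewrite expr2 -mulrA; apply: (pnorm_le_max p1 no0) => i.
rewrite -ler_sqr ?nnegrE; [|exact: normr_ge0|exact: no0].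
rewrite real_normK ?num_real//.
apply: (@le_trans _ _ (\sum_i x i ord0 ^+ 2)).
  by rewrite (bigD1 i)//= lerDl; apply: sumr_ge0 => j _; exact: sqr_ge0.
apply: le_trans H _; apply: le_trans (le_sum_sqr_optimal xs p0) _.
rewrite exprMn; apply: ler_wpM2r; first exact: sqr_ge0.
by rewrite -natrX ler_nat; case: (n) => // m; rewrite leq_pmulr.
Qed.

Lemma l2_point_optimal n (x y : 'cV[R]_n) :
  \sum_i x i ord0 ^+ 2 <= \sum_i y i ord0 ^+ 2 -> lp_norm 2 x <= lp_norm 2 y.
Proof.
move=> H; rewrite !lp_normE pnorm_le ?pnorm_ge0// powR_pnorm ?pnatr_eq0//.
have E (z : 'cV[R]_n) : \sum_i `|z i ord0| `^ 2 = \sum_i z i ord0 ^+ 2.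
  by apply: eq_bigr => i _; rewrite powR_mulrn// real_normK ?num_real.
by rewrite !E.
Qed.

Lemma seventh_le (u : R) : u <= 7^-1 -> u <= 2^-1 /\ u <= 1.
Proof. by move=> u7; split; lra. Qed.

(** The factors are the slack of the accepted test, the final ratio of the bisection and the slack
    of its lower end. *)
Lemma accuracy_product (u e : R) : 0 < u -> u <= 7^-1 -> 7 * u <= e ->
  (1 + 2 * u) * (1 + u) * (1 + u) <= 1 + e.
Proof. by move=> u0 u7 ue; nra. Qed.

End regression.

Theorem theorem2 (R : realType) (p : R) (hp : 2 <= p) :
  exists (alg : forall d n : nat, R -> iter_alg R d n) (C : R),
    0 < C /\
    forall (d n : nat) (A : 'M[R]_(d, n)) (b : 'cV[R]_d) (eps : R)
           (solver : 'rV[R]_n -> 'cV[R]_d),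
      (exists x0 : 'cV[R]_n, A *m x0 = b) ->
      0 < eps ->
      is_solver A b solver ->
      let x := (run_alg A solver (alg d n eps)).1 in
      let calls := (run_alg A solver (alg d n eps)).2 in
      [/\ A *m x = b,
          exists2 xs : 'cV[R]_n,
            lp_optimal p A b xs & lp_norm p x <= (1 + eps) * lp_norm p xs,
          forall c, c \in calls -> forall D, D \in c -> valid_call A b D &
          (3 <= n)%N -> eps <= 1 ->
            (size calls)%:R <= C * subproblem_bound n eps /\
            forall c, c \in calls -> (size c)%:R <= C * call_bound p n eps].
Proof.
have p1 : 1 < p by apply: lt_le_trans hp; rewrite ltr1n.
have p0 : 0 < p by apply: lt_trans p1.
have sc0 := subproblem_const_gt0 R.
pose C := subproblem_const R + `|call_const p| + 1.
exists (lp_regression p), C; split; first by rewrite ltr_wpDl// addr_ge0// ltW.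
move=> d n A b eps solver feas eps0 solverP.
have [xs xsP] := lp_optimal_exists p1 feas.
have [Axs xs_min] := xsP.
have r1 (i : 'I_n) : 0 < (1 : R) by exact: ltr01.
have vD := valid_conductances feas r1.
have phiP := solverP _ vD.
have Ax0 := wls_point_feasible phiP.
have x0_min (y : 'cV[R]_n) : A *m y = b ->
    \sum_i wls_point (fun=> 1) (A^T *m solver (conductances (fun=> 1))) i ord0 ^+ 2
    <= \sum_i y i ord0 ^+ 2.
  move=> Ay; have := wls_energy_le r1 phiP Ay.
  by under eq_bigr do rewrite mul1r; under [in leRHS]eq_bigr do rewrite mul1r.
have o0 : 0 <= lp_norm p xs by exact: pnorm_ge0.
have C_sub : (3 <= n)%N -> eps <= 1 ->
    (bisection_steps n (eps / 7)).+1%:R <= C * subproblem_bound n eps.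
  move=> n3 e1; have e01 : 0 < eps <= 1 by rewrite eps0.
  have H := bisection_steps_le n3 e01; apply: le_trans H _.
  apply: ler_wpM2r; last by rewrite /C -addrA lerDl addr_ge0.
  (* The bound is nonnegative because a positive multiple of it exceeds a natural number. *)
  by rewrite -(pmulr_rge0 _ sc0); apply: le_trans (bisection_steps_le n3 e01).
have C_call : (3 <= n)%N -> eps <= 1 -> 1 <= C * call_bound p n eps.
  move=> n3 e1; have e01 : 0 < eps <= 1 by rewrite eps0.
  have H := call_bound_ge1 hp n3 e01; apply: (le_trans H).
  apply: ler_peMl; first exact: le_trans ler01 H.
  by rewrite /C lerDr addr_ge0// ltW.
rewrite /lp_regression /=.
move: (wls_point _ _) Ax0 x0_min => x0 Ax0 x0_min.
set delta := Num.min eps 1 / 7.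
have in_calls (l : seq (seq 'rV[R]_n)) :
    (forall c, c \in l -> forall D, D \in c -> valid_call A b D) ->
    forall c, c \in [:: conductances (fun=> 1)] :: l ->
      forall D, D \in c -> valid_call A b D.
  move=> H c; rewrite inE => /orP[/eqP-> D|/H//].
  by rewrite inE => /eqP ->.
case: ifPn => [/orP early|].
  split; [exact: Ax0| |exact: in_calls|].
    exists xs; first exact: xsP.
    apply: (@le_trans _ _ (lp_norm p xs)); last by rewrite ler_peMl// lerDl ltW.
    case: early => [/eqP->|/eqP->//].
    exact: l2_point_optimal (x0_min _ Axs).
  move=> n3 e1; split.
    by apply: le_trans (C_sub n3 e1); rewrite ler_nat.
  by move=> c; rewrite inE => /eqP ->; exact: C_call.
rewrite negb_or => /andP[pN2 U0].
have p2 : 2 < p by rewrite lt_neqAle eq_sym pN2.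
have {}U0 : 0 < lp_norm p x0 by rewrite lt_neqAle eq_sym U0; exact: pnorm_ge0.
have n0 : (0 < n)%N.
  rewrite lt0n; apply: contraTneq U0 => n0; rewrite -leNgt.
  have := l2_point_bound (ltW p1) (x0_min _ Axs).
  have -> : n%:R = 0 :> R by rewrite n0.
  by rewrite expr2 !mul0r.
have nn0 : 0 < n%:R :> R by rewrite ltr0n.
have m0 : 0 < Num.min eps 1 by rewrite lt_min eps0 ltr01.
have m1 : Num.min eps 1 <= 1 by rewrite ge_min lexx orbT.
have me : Num.min eps 1 <= eps by rewrite ge_min lexx.
have d0 : 0 < delta by rewrite divr_gt0.
have d7 : delta <= 7^-1 by rewrite -[leRHS]mul1r ler_wpM2r// invr_ge0.
have [d_half d1] := seventh_le d7.
have d01 : 0 < delta <= 1 by rewrite d0.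
have n20 : 0 < n%:R ^+ 2 :> R by rewrite exprn_gt0.
have L0 : 0 < lp_norm p x0 / n%:R ^+ 2 by exact: divr_gt0.
have n21 : 1 <= n%:R ^+ 2 :> R by rewrite exprn_ege1// ler1n.
have LU : lp_norm p x0 / n%:R ^+ 2 <= lp_norm p x0.
  rewrite (ler_pdivrMr _ _ n20); apply: ler_peMr; [exact: ltW U0|exact: n21].
have Lo : lp_norm p x0 / n%:R ^+ 2 <= (1 + delta) * lp_norm p xs.
  apply: (@le_trans _ _ (lp_norm p xs)); last first.
    by apply: ler_peMl; [exact: o0|rewrite lerDl ltW].
  rewrite (ler_pdivrMr _ _ n20) mulrC.
  exact: l2_point_bound (ltW p1) (x0_min _ Axs).
have xU : lp_norm p x0 <= (1 + 2 * delta) * lp_norm p x0.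
  apply: ler_peMl; first exact: ltW U0.
  by rewrite lerDl mulr_ge0// ltW.
have [Aa [t [t0 tE ta]] sza va] := run_bisection p2 d0 d_half
  (width_ge2 p n delta) feas solverP n0 (good_steps_ge0 p2 n0 d01)
  (truncnS_gt _) (bisection_steps n delta) Axs L0 LU Lo Ax0 xU.
move: Aa ta sza va; move: (run_alg _ _ _) => a Aa ta sza va.
split; [exact: Aa| | |].
- exists xs; first exact: xsP.
  (* [t^(2^k)] is the initial ratio [n^2], and the number of rounds was chosen so that this is at
     most [(1 + delta)^(2^k)]. *)
  have td : t <= 1 + delta.
    have k0 : (0 < 2 ^ bisection_steps n delta)%N by rewrite expn_gt0.
    have D0 : 0 <= 1 + delta by rewrite addr_ge0// ltW.
    rewrite -(ler_pXn2r k0) ?nnegrE// tE.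
    apply: le_trans (bisection_steps_ge n0 d01).
    by rewrite invf_div mulrCA mulfV ?gt_eqF// mulr1.
  apply: le_trans ta _; rewrite (mulrA t) (mulrA (1 + 2 * delta)) mulrA.
  apply: ler_wpM2r; first exact: o0.
  apply: (@le_trans _ _ ((1 + 2 * delta) * (1 + delta) * (1 + delta))).
    apply: ler_wpM2r; first by rewrite addr_ge0// ltW.
    by apply: (ler_wpM2l _ td); rewrite addr_ge0// mulr_ge0// ltW.
  by apply: accuracy_product d0 d7 _; rewrite /delta mulrCA mulfV ?mulr1.
- apply: in_calls => c /va[_]; exact.
move=> n3 e1; have me1 : Num.min eps 1 = eps by apply/min_idPl.
move: sza va; rewrite /delta me1 => sza va; split.
  by rewrite /= sza; exact: C_sub.
move=> c; rewrite inE => /orP[/eqP->|/va[-> _]]; first exact: C_call.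
have e01 : 0 < eps <= 1 by rewrite eps0.
have cb0 : 0 <= call_bound p n eps.
  by apply: le_trans (call_bound_ge1 hp n3 e01).
apply: le_trans (irls_steps_le p2 n3 e01) _; apply: ler_wpM2r; first exact: cb0.
rewrite /C -addrA addrCA; apply: le_trans (ler_norm _) _.
by rewrite lerDl addr_ge0// ltW.
Qed.
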